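(* Let $\mathfrak g$ be of type $C_n$ ($n\ge2$) and let $I\subseteq\Pi$ have cardinality $r$ with $1\le r\le n-1$. (1) If $2e_n\in I$, then $\chi(\mathtt{Shi}(I),t)$ does not depend on which other $r-1$ simple roots $I$ contains, and $$\exp(\mathtt{Shi}(I))=\{(2n-2r+1)^{n-r+1},(2n-2r+3)^1,(2n-2r+5)^1,\dots,(2n-1)^1\}.$$ In particular, the number of regions is $(2n-2r+2)^{n-r}(2n)!!/(2n-2r)!!$ and the number of bounded regions is $(2n-2r)^{n-r}(2n-2)!!/(2n-2r-2)!!$. (2) If $2e_n\notin I$, then $\chi(\mathtt{Shi}(I),t)$ does not depend on which $r$ simple roots $I$ contains, and $$\exp(\mathtt{Shi}(I))=\{(2n-2r)^{n-r},(2n-2r+1)^1,(2n-2r+3)^1,\dots,(2n-1)^1\}.$$ In particular, the number of regions is $(2n-2r+1)^{n-r}(2n)!!/(2n-2r)!!$ and the number of bounded regions is $(2n-2r-1)^{n-r}(2n-2)!!/(2n-2r-2)!!$.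
   Context: $V=\mathbb R^n$ with the standard inner product $(\,,\,)$; positive roots $\Delta^+=\{e_i\pm e_j\mid1\le i<j\le n\}\cup\{2e_i\mid 1\le i\le n\}$, simple roots $\Pi=\{e_1-e_2,\dots,e_{n-1}-e_n,2e_n\}$. $H_{\alpha,k}=\{v\in V\mid(v,\alpha)=k\}$, $\mathtt{Cox}=\{H_{\alpha,0}\mid\alpha\in\Delta^+\}$. $\Delta_I$ is the subroot system spanned by $I$, $\Delta_I^+=\Delta_I\cap\Delta^+$, $C_I=\{\beta\in\Delta^+\setminus\Delta_I\mid\beta-\alpha\notin\Delta\ \forall\alpha\in\Delta_I^+\}$, $\mathtt{Shi}(I)=\mathtt{Cox}\cup\{H_{\alpha,1}\mid\alpha\in C_I\}$. For an arrangement $\mathcal A$ in $V$, $L(\mathcal A)$ is the poset of nonempty intersections of subsets of $\mathcal A$ (including $V$) ordered by reverse inclusion, $\chi(\mathcal A,t)=\sum_{x\in L(\mathcal A)}\mu(V,x)t^{\dim x}$, and $\exp(\mathcal A)$ is the multiset of roots of $\chi(\mathcal A,t)$, written $\{a_1^{m_1},\dots\}$ with multiplicities. Regions are connected components of the complement of the union of the hyperplanes. $m!!$ denotes the double factorial. *)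

(* Defs.v *)
From HB Require Import structures.
From mathcomp Require Import all_boot all_order all_algebra all_field.
From mathcomp Require Import finmap.
From mathcomp Require Import all_classical all_reals all_analysis.

Set Implicit Arguments.
Unset Strict Implicit.
Unset Printing Implicit Defensive.

Import Order.TTheory GRing.Theory Num.Theory.
Import numFieldNormedType.Exports.

Local Open Scope classical_set_scope.
Local Open Scope ring_scope.

Fixpoint dfact (m : nat) : nat := if m is m'.+2 then (m * dfact m')%N else 1%N.

(* Quotients of double factorials of the same parity are exact. *)
Lemma dvdn_dfact (m k : nat) : (dfact m %| dfact (m + 2 * k))%N.
Proof.
elim: k => [|k IH]; first by rewrite muln0 addn0.
by rewrite mulnS addnCA; apply: dvdn_mull.
Qed.

Section RootSystemC.
Variables (R : realType) (n : nat).
Local Notation V := 'rV[R]_n.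

Definition inner (u v : V) : R := \sum_(i < n) u 0 i * v 0 i.

(* The standard basis indexed from 1, so that [ebasis 1], ..., [ebasis n] are
   e_1, ..., e_n; [ebasis k] is 0 outside that range. *)
Definition ebasis (k : nat) : V := \row_(j < n) (j.+1 == k)%:R.

Definition pos_roots : set V :=
  [set v | exists i j : nat, [/\ (1 <= i)%N, (i < j)%N, (j <= n)%N
                              & v = ebasis i + ebasis j \/ v = ebasis i - ebasis j]]
  `|` [set v | exists i : nat, (1 <= i <= n)%N /\ v = 2 *: ebasis i].

Definition root_system : set V := pos_roots `|` [set - v | v in pos_roots].

Definition simple_roots : set V :=
  [set v | exists i : nat, (1 <= i < n)%N /\ v = ebasis i - ebasis i.+1]
  `|` [set 2 *: ebasis n].

Definition sub_roots (I : {fset V}) : set V :=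
  [set v | root_system v /\ v \in <<enum_fset I>>%VS].

Definition sub_pos_roots (I : {fset V}) : set V := sub_roots I `&` pos_roots.

Definition shi_roots (I : {fset V}) : set V :=
  [set b | [/\ pos_roots b, ~ sub_roots I b
             & forall a, sub_pos_roots I a -> ~ root_system (b - a)]].

Definition hyperplane (a : V) (k : R) : set V := [set v | inner v a = k].

Definition Cox : set (set V) := [set hyperplane a 0 | a in pos_roots].

Definition Shi (I : {fset V}) : set (set V) :=
  Cox `|` [set hyperplane a 1 | a in shi_roots I].

End RootSystemC.

Section IntersectionPoset.
Variables (R : realType) (n : nat).
Local Notation V := 'rV[R]_n.
Implicit Types (A L : set (set V)) (x y z : set V).

(* The subset [B = set0] gives the whole space. *)
Definition intersection_poset A : set (set V) :=
  [set x | x !=set0 /\ exists2 B, B `<=` A & x = \bigcap_(H in B) H].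

(* The Moebius function of [L] ordered by reverse inclusion, by its defining
   recursion mu(y, y) = 1 and mu(y, x) = - sum_(y <= z < x) mu(y, z) for y < x.
   The counter [k] only makes the recursion structural: a chain in a finite [L]
   has at most #|L| elements (see [mobius_recursion]). *)
Fixpoint mobius_rec L (k : nat) y x : int :=
  if k is k'.+1 then
    if x == y then 1
    else - \sum_(z \in [set z | [/\ L z, z `<=` y & x `<` z]]) mobius_rec L k' y z
  else 0.

Definition mobius L y x : int := mobius_rec L #|` fset_set L| y x.

(* The dimension of an affine subspace p + U is that of its direction U,
   which it determines (see [affine_dimE]). *)
Definition affine_dim x : nat :=
  \dim (xget 0%VS [set U : {vspace V} | exists p : V,
                     x = [set p + u | u in [set` U]]]).

Definition arr_poly A : {poly int} :=
  \sum_(x \in intersection_poset A)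
    mobius (intersection_poset A) setT x *: 'X^(affine_dim x).

(* The roots, with multiplicities, of the characteristic polynomial; they are
   taken in an algebraically closed field so that none is missed. *)
Definition exponents A : seq algC :=
  sval (closed_field_poly_normal (map_poly intr (arr_poly A))).

Definition complement A : set V := ~` \bigcup_(H in A) H.

Definition regions A : set (set V) :=
  [set connected_component (complement A) v | v in complement A].

Definition bounded_regions A : set (set V) := regions A `&` bounded_set.

End IntersectionPoset.

Lemma mobius_recursion (R : realType) (n : nat) (L : set (set 'rV[R]_n)) y x :
  finite_set L -> L y -> L x ->
  mobius L y x =
    if x == y then 1
    else - \sum_(z \in [set z | [/\ L z, z `<=` y & x `<` z]]) mobius L y z.
Proof.
move=> finL Ly Lx.
pose up x := fset_set [set z | L z /\ x `<=` z].
have finup x' : finite_set [set z | L z /\ x' `<=` z].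
  by apply: sub_finite_set finL => z [].
have mem_up x' : L x' -> x' \in up x'.
  by move=> Lx'; rewrite in_fset_set // inE; split.
have stable k : forall x, (#|` up x| <= k)%N ->
    L x -> forall k', (#|` up x| <= k')%N ->
    mobius_rec L k y x = mobius_rec L k' y x.
  elim: k => [|k IH] x' le_k Lx' [|k'] le_k' //.
  - have := mem_up _ Lx'.
    by move: le_k; rewrite leqn0 cardfs_eq0 => /eqP ->.
  - have := mem_up _ Lx'.
    by move: le_k'; rewrite leqn0 cardfs_eq0 => /eqP ->.
  rewrite /=; case: ifP => // _; congr (- _).
  apply: eq_fsbigr => z; rewrite inE => -[Lz zy xz].
  have ltc : (#|` up z| < #|` up x'|)%N.
    apply: fproper_ltn_card; rewrite fproperE; apply/andP; split.
      apply/fsubsetP => w; rewrite !in_fset_set // !inE => -[Lw zw]; split=> //.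
      by apply: subset_trans zw; case: xz.
    apply/fsubsetPn; exists x'; first exact: mem_up.
    by rewrite in_fset_set //; apply/negP; rewrite inE => -[_]; case: xz.
  by apply: IH => //; rewrite -ltnS; apply: leq_trans ltc _.
have le_up z : (#|` up z| <= #|` fset_set L|)%N.
  apply: fsubset_leq_card; apply/fsubsetP => w.
  by rewrite !in_fset_set // !inE => -[].
rewrite {1}/mobius (@stable _ x _ _ #|` fset_set L|.+1) //; last exact: leqW.
Qed.

Lemma affine_dimE (R : realType) (n : nat) (p : 'rV[R]_n)
    (U : {vspace 'rV[R]_n}) :
  affine_dim [set p + u | u in [set` U]] = \dim U.
Proof.
rewrite /affine_dim; case: xgetP => [W _ [q eqX]|/(_ U)]; last first.
  by case; exists p.
have shift (p1 p2 : 'rV[R]_n) (U1 U2 : {vspace 'rV[R]_n}) :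
    [set p1 + u | u in [set` U1]] = [set p2 + u | u in [set` U2]] ->
    (U1 <= U2)%VS.
  move=> E; apply/subvP => u U1u.
  have [u1 U2u1 E1] : [set p2 + u | u in [set` U2]] (p1 + u).
    by rewrite -E; exists u.
  have [u0 U2u0 E0] : [set p2 + u | u in [set` U2]] p1.
    by rewrite -E; exists 0; rewrite ?addr0 //= mem0v.
  have -> : u = u1 - u0.
    by apply: (addrI p1); rewrite -E1 -E0 addrACA subrr addr0.
  by rewrite memvB.
by congr (\dim _); apply/eqP; rewrite eqEsubv (shift _ _ _ _ eqX) (shift _ _ _ _ (esym eqX)).
Qed.

(* Main.v *)
Require Import Defs.
From HB Require Import structures.
From mathcomp Require Import all_boot all_order all_algebra all_field.
From mathcomp Require Import finmap.
From mathcomp Require Import zify ring lra.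
From mathcomp Require Import all_classical all_reals all_analysis.

Set Implicit Arguments.
Unset Strict Implicit.
Unset Printing Implicit Defensive.

Import Order.TTheory GRing.Theory Num.Theory.
Import numFieldNormedType.Exports.

Local Open Scope classical_set_scope.
Local Open Scope ring_scope.

(* Let K be the set of the indices of the simple roots outside I, with k = |K|.
   The roots of C_I are then e_s + e_s' and e_s - e_(s'+1) for s <= s' in K.

   The characteristic polynomial is computed by the finite field method: modulo
   a large prime q the points off the arrangement are the placements of
   +-1, ..., +-n at opposite nonzero points of a circle of q points in which no
   s in K immediately follows some - s' (s' in K) or some s'+1 (s <= s' in K).
   Removing the smallest s in K together with - s gives an admissible placement
   on a circle of q - 2 points, and s can be put back in all the gaps but those
   following one of the forbidden letters that are left; their number decreases
   in step with the size of the circle, so that every s in K contributes the same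
   factor q - 2 k - [2 e_n in I].

   The regions are counted by Zaslavsky's theorems.  The characteristic
   polynomial is the alternating sum of t^dim over the intersections of the
   hyperplanes (Whitney), so its value at -1, resp. at 1, is the value on the
   complement of the additive invariant equal to (-1)^dim, resp. 1, on affine
   subspaces; the first is (-1)^n on each region and the second (-1)^n on each
   bounded region and 0 on the others. *)

(** * Alternating sums and sums over sign choices *)

(** Everything is carried by one recursion, [altsum], over lists of forms instead of intersections:
    the characteristic polynomial, the number of points off the arrangement modulo q and the totals
    of both Euler characteristics are alternating sums over sublists, so they can be compared one
    subsystem at a time. Modulo q this comparison rests on the Smith normal form, which makes the
    ranks of a subsystem the same over R and over the field of q elements for large q.

    The smallest letter of K is the one to remove because its forbidden predecessors include those
    of every later letter of K, so that its removal creates no forbidden adjacency. When s is put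
    back among m later letters of K, the forbidden predecessors are the m letters - s' and the
    letters s'+1 with s' >= s in K: m + 1 of these, or m if n is in K, as n+1 is not a letter.

    The points of the circle are integers of absolute value at most M, with q = 2 M + 1, which turns
    adjacency into linear arithmetic; the wrap-around survives only as x s <> - M. *)

Section AlternatingSums.
Variables (T : eqType) (G : zmodType).
Implicit Types (f g : seq T -> G) (E A S : seq T).

(* The sum over the subsequences B of A of (-1)^|B| f (rev B ++ E). *)
Fixpoint altsum f E A : G :=
  if A is h :: A' then altsum f E A' - altsum f (h :: E) A' else f E.

Definition eqmem_invariant f := forall E E', E =i E' -> f E = f E'.

Lemma eq_altsum f g E A : f =1 g -> altsum f E A = altsum g E A.
Proof. by move=> fg; elim: A E => //= h A IH E; rewrite !IH. Qed.

Variable opp : T -> T.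

(* [opp h] stands for the form h with the opposite sign. *)
Fixpoint cellsum f S A : G :=
  if A is h :: A' then cellsum f (h :: S) A' + cellsum f (opp h :: S) A' else f S.

Lemma eq_cellsum f g S A : f =1 g -> cellsum f S A = cellsum g S A.
Proof. by move=> fg; elim: A S => //= h A IH S; rewrite !IH. Qed.

Lemma cellsumD f g S A :
  cellsum (fun S => f S + g S) S A = cellsum f S A + cellsum g S A.
Proof. by elim: A S => //= h A IH S; rewrite !IH addrACA. Qed.

Lemma cellsum_eqmem f S S' A :
  eqmem_invariant f -> S =i S' -> cellsum f S A = cellsum f S' A.
Proof.
move=> fI; elim: A S S' => /= [|h A IH] S S' SS'; first exact: fI.
by congr (_ + _); apply: IH => // x; rewrite !inE SS'.
Qed.

Lemma cellsum_cons f h S A :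
  eqmem_invariant f -> cellsum (fun S => f (h :: S)) S A = cellsum f (h :: S) A.
Proof.
move=> fI; elim: A S => //= g A IH S; rewrite !IH; congr (_ + _);
  by apply: cellsum_eqmem => // x; rewrite !inE orbCA.
Qed.

(* If f E S is additive when the cell cut out by E = 0, S > 0 is split by h = 0,
   sieving out the hyperplanes of A leaves exactly the open cells. *)
Lemma altsum_cellsum (f : seq T -> seq T -> G) E S A :
  (forall E, eqmem_invariant (f E)) ->
  (forall h E S, h \in A ->
     f E S = f E (h :: S) + f E (opp h :: S) + f (h :: E) S) ->
  altsum (f ^~ S) E A = cellsum (f E) S A.
Proof.
move=> fI fA; elim: A E S fA => //= h A IH E S fA.
have fA' (k : T) E' S' : k \in A ->
    f E' S' = f E' (k :: S') + f E' (opp k :: S') + f (k :: E') S'.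
  by move=> kA; apply: fA; rewrite inE kA orbT.
(* Splitting every value by [h] produces three sums; the one with [h] among the equations cancels
   the subtracted term of [altsum]. *)
rewrite !IH // (eq_cellsum (g := fun S => f E (h :: S) + f E (opp h :: S) + f (h :: E) S)).
  by rewrite !cellsumD addrK !cellsum_cons.
by move=> S'; apply: fA; rewrite mem_head.
Qed.

End AlternatingSums.

Lemma raddf_altsum (T : eqType) (G H : zmodType) (phi : {additive G -> H})
    (f : seq T -> G) E A :
  phi (altsum f E A) = altsum (phi \o f) E A.
Proof. by elim: A E => //= h A IH E; rewrite raddfB !IH. Qed.

(** * Affine forms and their solution sets *)

Section AffineForms.
Variables (R : realType) (n : nat).
Local Notation V := 'rV[R]_n.
(* The pair [(a, c)] stands for the affine form v |-> (v, a) - c. *)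
Local Notation form := ('rV[R]_n * R)%type.
Implicit Types (h : form) (E A S : seq form) (u v w : V).

Lemma innerDl u v w : inner (u + v) w = inner u w + inner v w.
Proof. by rewrite -big_split; apply: eq_bigr => i _; rewrite mxE mulrDl. Qed.

Lemma innerZl c u w : inner (c *: u) w = c * inner u w.
Proof. by rewrite mulr_sumr; apply: eq_bigr => i _; rewrite mxE mulrA. Qed.

Lemma inner0l w : inner 0 w = 0 :> R.
Proof. by rewrite /inner big1 // => i _; rewrite mxE mul0r. Qed.

Lemma innerC u v : inner u v = inner v u.
Proof. by apply: eq_bigr => i _; rewrite mulrC. Qed.

Lemma innerNl u w : inner (- u) w = - inner u w.
Proof. by rewrite -scaleN1r innerZl mulN1r. Qed.

Lemma innerBl u v w : inner (u - v) w = inner u w - inner v w.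
Proof. by rewrite innerDl innerNl. Qed.

Lemma innerDr u v w : inner w (u + v) = inner w u + inner w v.
Proof. by rewrite innerC innerDl !(innerC w). Qed.

Lemma innerNr u w : inner w (- u) = - inner w u.
Proof. by rewrite innerC innerNl innerC. Qed.

Lemma inner_sqr_gt0 u : u != 0 -> 0 < inner u u.
Proof.
move=> u0; have [i ui0] : exists i, u 0 i != 0.
  apply/existsP; apply: contraR u0; rewrite negb_exists => /forallP u0.
  by apply/eqP/rowP => i; rewrite mxE; have := u0 i; rewrite negbK => /eqP.
rewrite /inner (bigD1 i) //= ltr_pwDl //; first by rewrite -expr2 exprn_even_gt0.
by apply: sumr_ge0 => j _; rewrite -expr2 sqr_ge0.
Qed.

Definition innerl w v : R^o := inner v w.

Fact innerl_linear w : linear (innerl w).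
Proof. by move=> c u v; rewrite /innerl innerDl innerZl. Qed.

HB.instance Definition _ w :=
  GRing.isLinear.Build R V R^o *:%R (innerl w) (innerl_linear w).

Definition innerhom w : 'Hom(V, R^o) := linfun (innerl w).

Lemma innerhomE w v : innerhom w v = inner v w.
Proof. by rewrite lfunE. Qed.

Definition sol E : set V := [set v | forall e, e \in E -> inner v e.1 = e.2].

Definition direction E : {vspace V} :=
  foldr (fun e U => (U :&: lker (innerhom e.1))%VS) fullv E.

Lemma sol_cons h E : sol (h :: E) = sol E `&` hyperplane h.1 h.2.
Proof.
apply/seteqP; split => v /=.
  by move=> vE; split=> [e eE|]; apply: vE; rewrite ?mem_head // inE eE orbT.
by case=> vE vh e; rewrite inE => /orP[/eqP->//|]; apply: vE.
Qed.

Lemma sol_nil : sol [::] = setT.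
Proof. by apply/seteqP; split. Qed.

Lemma eq_sol E E' : E =i E' -> sol E = sol E'.
Proof. by move=> EE'; apply/seteqP; split => v vE e; rewrite (EE', =^~ EE'); apply: vE. Qed.

Lemma mem_direction_cons h E w :
  (w \in direction (h :: E)) = (w \in direction E) && (inner w h.1 == 0).
Proof. by rewrite /direction /= memv_cap memv_ker innerhomE. Qed.

Lemma mem_direction E w :
  reflect (forall e, e \in E -> inner w e.1 = 0) (w \in direction E).
Proof.
elim: E => [|h E IH] /=; first by rewrite memvf; constructor.
rewrite -/(direction (h :: E)) mem_direction_cons; apply: (iffP andP).
  move=> [/IH wE /eqP wh] e; rewrite inE => /orP[/eqP->//|]; exact: wE.
move=> wE; split; last by apply/eqP/wE/mem_head.
by apply/IH => e eE; apply: wE; rewrite inE eE orbT.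
Qed.

Lemma eq_direction E E' : E =i E' -> direction E = direction E'.
Proof.
by move=> EE'; apply/vspaceP => w; apply/mem_direction/mem_direction => H e;
   rewrite (EE', =^~ EE'); apply: H.
Qed.

Lemma direction_cons_const h E :
  (forall w, w \in direction E -> inner w h.1 = 0) ->
  direction (h :: E) = direction E.
Proof.
move=> H; apply/eqP; rewrite eqEsubv /= capvSl; apply/subvP => w wE.
by rewrite memv_cap wE memv_ker innerhomE; apply/eqP/H.
Qed.

(** The functional maps [U] into the line [R^o] and is not 0 on it, so its image has dimension 1. *)
Lemma dim_cap_innerhom (U : {vspace V}) a w :
  w \in U -> inner w a != 0 -> \dim U = (\dim (U :&: lker (innerhom a))).+1.
Proof.
move=> wU wa; rewrite -(limg_ker_dim (innerhom a) U).
have le1 : (\dim (innerhom a @: U) <= 1)%N.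
  by apply: leq_trans (dimvS (subvf _)) _; rewrite dimvf.
have ne0 : \dim (innerhom a @: U) != 0%N.
  rewrite dimv_eq0; apply: contraNneq wa => E.
  by rewrite -innerhomE -memv0 -E memv_img.
by case: (\dim (innerhom a @: U)) le1 ne0 => [|[]] // _ _; rewrite addn1.
Qed.

Lemma dim_direction_cons h E w :
  w \in direction E -> inner w h.1 != 0 ->
  \dim (direction E) = (\dim (direction (h :: E))).+1.
Proof. exact: dim_cap_innerhom. Qed.

Lemma sol_direction E p : sol E p -> sol E = [set p + u | u in [set` direction E]].
Proof.
move=> pE; apply/seteqP; split => v /=.
  move=> vE; exists (v - p); last by rewrite addrC subrK.
  by apply/mem_direction => e eE; rewrite innerBl vE // pE // subrr.
by case=> u /mem_direction uE <- e eE; rewrite innerDl uE // addr0 pE.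
Qed.

Lemma affine_dim_sol E : sol E !=set0 -> affine_dim (sol E) = \dim (direction E).
Proof. by move=> [p pE]; rewrite (sol_direction pE) affine_dimE. Qed.

(** The value 0 on inconsistent systems restricts Whitney's sum to the sublists with nonempty
    intersection. *)
Definition solpoly E : {poly int} :=
  if `[< sol E !=set0 >] then 'X^(\dim (direction E)) else 0.

Definition arrangement A : set (set V) :=
  [set H | exists2 h, h \in A & H = hyperplane h.1 h.2].

End AffineForms.

Arguments direction : simpl never.

Lemma eq_altsum_in (T : eqType) (G : zmodType) (f g : seq T -> G) E A :
  (forall E', {subset E' <= E ++ A} -> f E' = g E') ->
  altsum f E A = altsum g E A.
Proof.
elim: A E => /= [|h A IH] E fg; first by apply: fg; rewrite cats0.
congr (_ - _); apply: IH => E' sub; apply: fg => x /sub;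
  by rewrite !(inE, mem_cat); do 2?[case/orP]; move=> ->; rewrite ?orbT.
Qed.

Lemma altsum_sum (T : eqType) (G : zmodType) (I : Type) (s : seq I) (P : pred I)
    (f : I -> seq T -> G) E A :
  altsum (fun E => \sum_(i <- s | P i) f i E) E A
  = \sum_(i <- s | P i) altsum (f i) E A.
Proof. by elim: A E => //= h A IH E; rewrite !IH sumrB. Qed.

Lemma altsum_scalel (T : eqType) (G : ringType) (M : lmodType G) (f : seq T -> G)
    (p : M) E A :
  altsum f E A *: p = altsum (fun E => f E *: p) E A.
Proof. by elim: A E => //= h A IH E; rewrite scalerBl !IH. Qed.

(** * Whitney's formula *)

Section Whitney.
Variables (R : realType) (n : nat) (A : seq ('rV[R]_n * R)).
Hypothesis A_proper : forall h, h \in A -> h.1 != 0.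
Local Notation V := 'rV[R]_n.
Local Notation L := (intersection_poset (arrangement A)).

Lemma intersection_posetE (x : set V) :
  L x <-> x !=set0 /\ exists2 B, {subset B <= A} & x = sol B.
Proof.
split=> [[x0 [B BA xB]]|[x0 [B BA xB]]]; split=> //; rewrite xB.
  (* Different forms may cut out the same hyperplane; every form of [A] whose hyperplane lies in [B]
     is kept. *)
  exists [seq h <- A | `[< B (hyperplane h.1 h.2) >]].
    by move=> h; rewrite mem_filter => /andP[].
  apply/seteqP; split => v /= vB.
    by move=> h; rewrite mem_filter => /andP[/asboolP /vB].
  by move=> H BH; have [h hA HE] := BA _ BH; rewrite HE;
     apply: vB; rewrite mem_filter hA andbT; apply/asboolP; rewrite -HE.
exists (arrangement B); first by move=> _ [h /BA hA ->]; exists h.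
apply/seteqP; split => v /= vB; first by move=> _ [h hB ->]; exact: vB.
by move=> h hB; apply: (vB (hyperplane h.1 h.2)); exists h.
Qed.

Lemma finite_intersection_poset : finite_set L.
Proof.
pose f (m : (size A).-tuple bool) := sol (mask m A).
apply: (@sub_finite_set _ _ [set f m | m in setT]); last first.
  exact/finite_image/finite_finset.
move=> x /intersection_posetE[_ [B BA ->]].
exists (map_tuple [in B] (in_tuple A)) => //=.
rewrite /f -filter_mask; apply: eq_sol => h.
by rewrite mem_filter andb_idr // => /BA.
Qed.

Let s := enum_fset (fset_set L).

Let mem_s x : (x \in s) = `[< L x >].
Proof.
rewrite -[x \in s]/(x \in fset_set L) in_fset_set; last exact: finite_intersection_poset.
by apply/idP/asboolP; rewrite inE.
Qed.

Let signcount x : int := altsum (fun E => (sol E == x)%:R) [::] A.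

(** If [x] lies in the hyperplane of [h], the sublists with and without [h] cancel; if not, only
    those without [h] contribute. *)
Let contain_altsum x E A' : {subset A' <= A} -> x !=set0 ->
  altsum (fun E => (`[< x `<=` sol E >])%:R) E A'
  = (`[< x `<=` sol E >] && all (fun h => ~~ `[< x `<=` hyperplane h.1 h.2 >]) A')%:R :> int.
Proof.
move=> sub x0; elim: A' sub E => [|h A' IH] sub E /=; first by rewrite andbT.
have sub' : {subset A' <= A} by move=> g gA; apply: sub; rewrite inE gA orbT.
rewrite !IH // sol_cons.
have -> : `[< x `<=` sol E `&` hyperplane h.1 h.2 >]
   = `[< x `<=` sol E >] && `[< x `<=` hyperplane h.1 h.2 >].
  rewrite -asbool_and; congr asbool; apply/propext; split.
    by move=> H; split=> v /H [].
  by move=> [H1 H2] v xv; split; [apply: H1|apply: H2].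
by case: (`[< x `<=` sol E >]); case: (`[< x `<=` hyperplane _ _ >]);
   case: (all _ _); rewrite /= ?subr0 ?subrr.
Qed.

(** The left side counts, with signs, the sublists of [A] whose intersection contains [x]. By
    [contain_altsum] it vanishes as soon as one hyperplane contains [x], that is, unless [x] is the
    whole space. *)
Let signcount_up x : L x ->
  \sum_(z <- s | `[< x `<=` z >]) signcount z = (x == setT)%:R.
Proof.
move=> Lx; have /intersection_posetE[x0 [B BA xB]] := Lx.
rewrite -altsum_sum (@eq_altsum_in _ _ _ (fun E => (`[< x `<=` sol E >])%:R)).
  rewrite contain_altsum // sol_nil; congr (nat_of_bool _)%:R.
  have -> : `[< x `<=` setT >] by apply/asboolP.
  apply/allP/eqP => [xA|-> h /A_proper h0].
    rewrite xB; apply/seteqP; split=> // v _ h hB.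
    have /xA /negP[] := BA _ hB; apply/asboolP; rewrite xB => u; exact.
  (* At this multiple of [h.1] the inner product with [h.1] is [h.2 + 1], so the hyperplane is not
     the whole space. *)
  apply/asboolP => /(_ ((h.2 + 1) / inner h.1 h.1 *: h.1) I) /=.
  rewrite /hyperplane /= innerZl divfK ?gt_eqF ?inner_sqr_gt0 // => /eqP.
  by rewrite -subr_eq0 addrAC subrr add0r oner_eq0.
move=> E sub; case: (asboolP (x `<=` sol E)) => [xE|nxE] /=; last first.
  by rewrite big1_seq // => z /andP[/asboolP xz _]; case: eqP => // Ez; case: nxE; rewrite Ez.
have Es : sol E \in s.
  rewrite mem_s; apply/asboolP/intersection_posetE; split; last by exists E.
  by case: x0 => v xv; exists v; apply: xE.
rewrite -big_filter (bigD1_seq (sol E)) ?filter_uniq ?fset_uniq //=; last first.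
  by rewrite mem_filter Es andbT; apply/asboolP.
by rewrite eqxx big1 ?addr0 // => z; rewrite eq_sym => /negPf->.
Qed.

(* The alternating count satisfies the defining recursion of the Moebius function. *)
Lemma mobius_signcount x : L x ->
  mobius L setT x = altsum (fun E => (sol E == x)%:R) [::] A.
Proof.
rewrite -/(signcount x).
have LT : L setT by apply/intersection_posetE; split; [exists 0|exists [::]; rewrite ?sol_nil].
have [k] := ubnP (size [seq z <- s | `[< x `<` z >]]).
elim: k x => // k IH x; rewrite ltnS => ltk Lx.
rewrite mobius_recursion //; last exact: finite_intersection_poset.
have := signcount_up Lx.
rewrite (bigID (pred1 x)) /= -big_filter (_ : [seq _ <- _ | _] = [:: x]); last first.
  rewrite (@eq_filter _ _ (pred1 x)); last first.
    by move=> z /=; case: eqP => [->|]; rewrite ?andbF ?andbT //; apply/asboolP.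
  by rewrite filter_pred1_uniq ?fset_uniq // mem_s; apply/asboolP.
rewrite big_seq1.
have -> : \sum_(z <- s | `[< x `<=` z >] && (z != x)) signcount z
   = \sum_(z <- s | `[< x `<` z >]) mobius L setT z.
  rewrite (eq_bigl (fun z => `[< x `<` z >])); last first.
    move=> z; apply/andP/asboolP => [[/asboolP xz /eqP zx]|].
      by split=> // zx'; apply: zx; apply/seteqP.
    by move=> [xz zx]; split; [apply/asboolP|apply/eqP => zx'; apply: zx; rewrite zx'].
  rewrite [LHS]big_seq_cond [RHS]big_seq_cond; apply: eq_bigr => z /andP[zs /asboolP xz].
  rewrite IH //; last by move: zs; rewrite mem_s => /asboolP.
  apply: leq_trans ltk; apply: (@uniq_leq_size _ (z :: [seq w <- s | `[< z `<` w >]])).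
    by rewrite /= filter_uniq ?fset_uniq // andbT mem_filter; apply/negP => /andP[/asboolP[_ zz] _]; exact: zz.
  move=> w; rewrite inE !mem_filter => /orP[/eqP->|/andP[/asboolP zw ->]].
    by rewrite zs andbT; apply/asboolP.
  by rewrite andbT; apply/asboolP; case: xz zw => xz nzx [zw _]; split=> [v /xz /zw //|wx]; apply: nzx => v /zw /wx.
have [->|xT] := eqVneq x setT.
  rewrite big1 ?addr0 ?eqxx // => z /asboolP [_ []]; exact: subsetT.
move/eqP; rewrite addr_eq0 => /eqP ->; congr (- _).
rewrite fsbig_finite /=; last first.
  by apply: sub_finite_set finite_intersection_poset => z [].
rewrite -[RHS]big_filter; apply: perm_big; apply: uniq_perm.
- exact: fset_uniq.
- exact/filter_uniq/fset_uniq.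
move=> z; rewrite mem_filter mem_s in_fset_set; last first.
  by apply: sub_finite_set finite_intersection_poset => z' [].
apply/idP/andP => [|[/asboolP xz /asboolP Lz]]; rewrite inE; last by split.
by move=> [Lz _ xz]; split; apply/asboolP.
Qed.

Lemma arr_poly_altsum : arr_poly (arrangement A) = altsum (@solpoly R n) [::] A.
Proof.
rewrite /arr_poly fsbig_finite /=; last exact: finite_intersection_poset.
rewrite -/s big_seq (eq_bigr (fun x =>
    altsum (fun E => (sol E == x)%:R *: 'X^(affine_dim x)) [::] A)); last first.
  by move=> x; rewrite mem_s => /asboolP Lx; rewrite mobius_signcount // altsum_scalel.
rewrite -big_seq -altsum_sum; apply: eq_altsum_in => E /= sub; rewrite /solpoly.
case: asboolP => [E0|nE]; last first.
  rewrite big1_seq // => x /andP[_]; rewrite mem_s => /asboolP/intersection_posetE[x0 _].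
  by case: eqP => [Ex|]; rewrite ?scale0r //; case: nE; rewrite Ex.
have Es : sol E \in s.
  by rewrite mem_s; apply/asboolP/intersection_posetE; split; last by exists E.
rewrite (bigD1_seq (sol E)) ?fset_uniq //= eqxx scale1r affine_dim_sol //.
by rewrite big1 ?addr0 // => z; rewrite eq_sym => /negPf->; rewrite scale0r.
Qed.

End Whitney.

(** * Euler characteristics of relatively open polyhedra *)

(* Locked: otherwise unifying [oppform h] with [h] unfolds the structures of R. *)
HB.lock Definition oppform (R : realType) (n : nat) (h : 'rV[R]_n * R) : 'rV[R]_n * R :=
  (- h.1, - h.2).

Section Polyhedra.
Variables (R : realType) (n : nat).
Local Notation V := 'rV[R]_n.
Local Notation form := ('rV[R]_n * R)%type.
Implicit Types (h : form) (E A S : seq form) (u v w : V).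

Lemma oppform1 h : (oppform h).1 = - h.1.
Proof. by rewrite oppform.unlock. Qed.

Lemma oppform2 h : (oppform h).2 = - h.2.
Proof. by rewrite oppform.unlock. Qed.

Definition polyhedron E S : set V :=
  sol E `&` [set v | forall s, s \in S -> s.2 < inner v s.1].

(** For a nonempty polyhedron this is its recession cone: strict inequalities become weak ones along
    a ray. Being read off the forms, it also makes sense when the polyhedron is empty. *)
Definition recession E S : set V :=
  [set w | w \in direction E /\ forall s, s \in S -> 0 <= inner w s.1].

Lemma eq_polyhedron E E' S S' : E =i E' -> S =i S' -> polyhedron E S = polyhedron E' S'.
Proof.
move=> EE' SS'; rewrite /polyhedron (eq_sol EE'); congr (_ `&` _).
by apply/seteqP; split => v vS s; rewrite (SS', =^~ SS'); apply: vS.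
Qed.

Lemma eq_recession E E' S S' : E =i E' -> S =i S' -> recession E S = recession E' S'.
Proof.
move=> EE' SS'; rewrite /recession (eq_direction EE').
by apply/seteqP; split => v /= [vE vS]; split=> // s; rewrite (SS', =^~ SS'); apply: vS.
Qed.

Lemma polyhedron_pos h E S :
  polyhedron E (h :: S) = polyhedron E S `&` [set v | h.2 < inner v h.1].
Proof.
apply/seteqP; split => v /=; last first.
  by case=> [[vE vS] vh]; split=> //= s; rewrite inE => /orP[/eqP->//|]; apply: vS.
case=> vE /= vS; split; last by apply: vS; rewrite mem_head.
by split=> //= s sS; apply: vS; rewrite inE sS orbT.
Qed.

Lemma polyhedron_neg h E S :
  polyhedron E (oppform h :: S) = polyhedron E S `&` [set v | inner v h.1 < h.2].
Proof.
by rewrite polyhedron_pos; congr (_ `&` _); apply/funext => v /=; rewrite oppform1 oppform2 innerNr ltrN2.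
Qed.

Lemma polyhedron_eq h E S :
  polyhedron (h :: E) S = polyhedron E S `&` [set v | inner v h.1 = h.2].
Proof. by rewrite /polyhedron sol_cons setIAC. Qed.

Lemma recession_pos h E S :
  recession E (h :: S) = recession E S `&` [set w | 0 <= inner w h.1].
Proof.
apply/seteqP; split => v /=; last first.
  by case=> [[vE vS] vh]; split=> //= s; rewrite inE => /orP[/eqP->//|]; apply: vS.
case=> vE /= vS; split; last by apply: vS; rewrite mem_head.
by split=> //= s sS; apply: vS; rewrite inE sS orbT.
Qed.

Lemma recession_neg h E S :
  recession E (oppform h :: S) = recession E S `&` [set w | inner w h.1 <= 0].
Proof.
by rewrite recession_pos; congr (_ `&` _); apply/funext => v /=; rewrite oppform1 innerNr oppr_ge0.
Qed.

Lemma recession_eq h E S :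
  recession (h :: E) S = recession E S `&` [set w | inner w h.1 = 0].
Proof.
apply/seteqP; split => w /=.
  by rewrite /recession /= mem_direction_cons => -[/andP[wE /eqP wh] wS].
by case=> -[wE wS] wh; split=> //; rewrite mem_direction_cons wE wh eqxx.
Qed.

Lemma polyhedron_convex E S x y t : polyhedron E S x -> polyhedron E S y ->
  0 <= t <= 1 -> polyhedron E S (x + t *: (y - x)).
Proof.
move=> [xE xS] [yE yS] /andP[t0 t1]; split => [e eE|s sS] /=.
  by rewrite innerDl innerZl innerBl xE // yE // subrr mulr0 addr0.
rewrite innerDl innerZl innerBl.
move: (xS _ sS) (yS _ sS) => /=; set a := inner x _; set b := inner y _ => xs ys.
have : 0 < (1 - t) * (a - s.2) + t * (b - s.2); last by lra.
have [->|t_lt1] := eqVneq t 1; first by rewrite subrr mul0r add0r mul1r subr_gt0.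
rewrite ltr_pwDl ?mulr_gt0 ?mulr_ge0 ?subr_gt0 ?subr_ge0 //; last exact: ltW.
by rewrite lt_neqAle t_lt1.
Qed.

Lemma polyhedron_cross h E S x y : polyhedron E S x -> polyhedron E S y ->
  inner x h.1 < h.2 -> h.2 < inner y h.1 -> polyhedron (h :: E) S !=set0.
Proof.
move=> xP yP xh yh; rewrite polyhedron_eq.
have d0 : 0 < inner y h.1 - inner x h.1 by rewrite subr_gt0 (lt_trans xh).
exists (x + ((h.2 - inner x h.1) / (inner y h.1 - inner x h.1)) *: (y - x)); split.
  apply: polyhedron_convex => //; apply/andP; split.
    by apply: divr_ge0; rewrite ?(ltW d0) // subr_ge0 ltW.
  by rewrite ler_pdivrMr // mul1r lerD2r ltW.
by rewrite /= innerDl innerZl innerBl divfK ?gt_eqF // addrC subrK.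
Qed.

Lemma polyhedron_open E S z w : polyhedron E S z -> w \in direction E ->
  exists2 d, 0 < d & forall t, `|t| <= d -> polyhedron E S (z + t *: w).
Proof.
move=> [zE zS] /mem_direction wE.
have [d d0 dS] : exists2 d, 0 < d &
    forall t, `|t| <= d -> forall s, s \in S -> s.2 < inner (z + t *: w) s.1.
  elim: S zS => [|s S IH] zS; first by exists 1.
  have [|d d0 dS] := IH; first by move=> s' s'S; apply: zS; rewrite inE s'S orbT.
  have gap : 0 < inner z s.1 - s.2 by rewrite subr_gt0 zS ?mem_head.
  have den : 0 < 1 + `|inner w s.1| by rewrite ltr_pwDl.
  (* With this bound [d' * |inner w s.1|] stays below the gap by [d']; the added 1 avoids a division
     by 0. *)
  set d' := (inner z s.1 - s.2) / (1 + `|inner w s.1|).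
  have d'0 : 0 < d' by rewrite divr_gt0.
  have d'E : d' * (1 + `|inner w s.1|) = inner z s.1 - s.2 by rewrite divfK ?gt_eqF.
  exists (Num.min d d'); first by rewrite lt_min d0.
  move=> t; rewrite le_min => /andP[td ts] s'; rewrite inE => /orP[/eqP->|]; last exact: dS.
  rewrite innerDl innerZl.
  have : `|t * inner w s.1| <= d' * `|inner w s.1| by rewrite normrM ler_wpM2r.
  by rewrite ler_norml => /andP[+ _]; nra.
exists d => // t td; split; last exact: dS.
by move=> e eE; rewrite innerDl innerZl wE // mulr0 addr0 zE.
Qed.

Lemma polyhedron_sides h E S z w :
  polyhedron E S z -> inner z h.1 = h.2 -> w \in direction E -> inner w h.1 != 0 ->
  polyhedron E (h :: S) !=set0 /\ polyhedron E (oppform h :: S) !=set0.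
Proof.
move=> zP zh wE wh.
have [d d0 dP] := polyhedron_open zP wE.
have zt t : inner (z + t *: w) h.1 = h.2 + t * inner w h.1 by rewrite innerDl innerZl zh.
have dN t : `|t| = d -> polyhedron E S (z + t *: w) by move=> td; apply: dP; rewrite td.
have nd : `|d| = d by rewrite gtr0_norm.
rewrite polyhedron_pos polyhedron_neg.
move: wh; rewrite neq_lt => /orP[] wh; split.
- by exists (z + (- d) *: w); split; [apply: dN; rewrite normrN|rewrite /= zt; nra].
- by exists (z + d *: w); split; [apply: dN|rewrite /= zt; nra].
- by exists (z + d *: w); split; [apply: dN|rewrite /= zt; nra].
- by exists (z + (- d) *: w); split; [apply: dN; rewrite normrN|rewrite /= zt; nra].
Qed.

Lemma polyhedron_recession E S x w t : polyhedron E S x -> recession E S w -> 0 <= t ->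
  polyhedron E S (x + t *: w).
Proof.
move=> [xE xS] [/mem_direction wE wS] t0; split => [e eE|s sS] /=.
  by rewrite innerDl innerZl wE // mulr0 addr0 xE.
by rewrite innerDl innerZl ltr_wpDr ?mulr_ge0 ?wS ?xS.
Qed.

Lemma recessionD E S u w : recession E S u -> recession E S w -> recession E S (u + w).
Proof.
by move=> [uE uS] [wE wS]; split=> [|s sS]; rewrite ?memvD // innerDl addr_ge0 ?uS ?wS.
Qed.

Lemma recessionZ E S t w : 0 <= t -> recession E S w -> recession E S (t *: w).
Proof.
by move=> t0 [wE wS]; split=> [|s sS]; rewrite ?memvZ // innerZl mulr_ge0 ?wS.
Qed.

(* The Euler characteristic with compact supports. *)
Definition euler E S : int :=
  (-1) ^+ \dim (direction E) *+ `[< polyhedron E S !=set0 >].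

(** If [h] cuts the polyhedron transversally, the three pieces are nonempty, two of the same
    dimension and one of dimension one less, and x = x + x - x. Otherwise exactly one piece is
    nonempty, and it is the whole polyhedron. *)
Lemma euler_additive h E S :
  euler E S = euler E (h :: S) + euler E (oppform h :: S) + euler (h :: E) S.
Proof.
rewrite /euler.
have [] := asboolP (polyhedron E S !=set0) => /=; last first.
  move=> P0; rewrite polyhedron_pos polyhedron_neg polyhedron_eq.
  by do !(case: asboolP => [[v [vP _]]|_]; first by case: P0; exists v).
move=> P0; have [] := asboolP (polyhedron (h :: E) S !=set0) => /=; last first.
  move=> noz; rewrite addr0; have noz' v : polyhedron E S v -> inner v h.1 <> h.2.
    by move=> vP vh; apply: noz; exists v; rewrite polyhedron_eq.
  have [x xP] := P0; case: (ltrgtP (inner x h.1) h.2) => [xh|xh|/noz' //].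
    have -> : `[< polyhedron E (oppform h :: S) !=set0 >].
      by apply/asboolP; exists x; rewrite polyhedron_neg.
    case: asboolP => [[y]|_]; last by rewrite add0r.
    by rewrite polyhedron_pos => -[yP yh]; case: noz; apply: polyhedron_cross xP yP xh yh.
  have -> : `[< polyhedron E (h :: S) !=set0 >].
    by apply/asboolP; exists x; rewrite polyhedron_pos.
  case: asboolP => [[y]|_]; last by rewrite addr0.
  by rewrite polyhedron_neg => -[yP yh]; case: noz; apply: polyhedron_cross yP xP yh xh.
move=> [z]; rewrite polyhedron_eq => -[zP zh].
have [hconst|] := pselect (forall w, w \in direction E -> inner w h.1 = 0).
  rewrite (direction_cons_const hconst).
  have const v : polyhedron E S v -> inner v h.1 = h.2.
    move=> [vE _]; have [zE _] := zP; move: vE; rewrite (sol_direction zE) => -[u uE <-].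
    by rewrite innerDl (hconst u) // addr0.
  case: asboolP => [[v]|_]; first by rewrite polyhedron_pos => -[/const /= ->]; rewrite ltxx.
  case: asboolP => [[v]|_]; first by rewrite polyhedron_neg => -[/const /= ->]; rewrite ltxx.
  by rewrite !add0r.
move=> /existsNP[w /not_implyP[wE /eqP wh]].
have [pos neg] := polyhedron_sides zP zh wE wh.
rewrite !asboolT // (dim_direction_cons wE wh) /=.
by move: (\dim _) => d; rewrite exprS; ring.
Qed.

End Polyhedra.

(** * The Euler characteristic that detects bounded cells *)

Section RecessionEuler.
Variables (R : realType) (n : nat).
Local Notation V := 'rV[R]_n.
Local Notation form := ('rV[R]_n * R)%type.
Implicit Types (h : form) (E A S : seq form) (u v w : V).

Definition recession_linear E S := forall w, recession E S w -> recession E S (- w).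

Definition lineality E S := direction (E ++ S).

Lemma mem_lineality E S w :
  w \in lineality E S <-> recession E S w /\ recession E S (- w).
Proof.
split=> [/mem_direction H|[[/mem_direction wE wS] [_ wS']]].
  by split; (split; [apply/mem_direction => e eE|move=> s sS];
     rewrite ?innerNl ?H ?oppr0 // mem_cat ?eE ?sS ?orbT).
apply/mem_direction => e; rewrite mem_cat => /orP[/wE//|eS].
by apply/eqP; rewrite eq_le wS // andbT -oppr_ge0 -innerNl wS'.
Qed.

Lemma lineality_eq h E S : lineality (h :: E) S = direction (h :: E ++ S).
Proof. by []. Qed.

Lemma lineality_pos h E S : lineality E (h :: S) = direction (h :: E ++ S).
Proof. by apply: eq_direction => x; rewrite !(inE, mem_cat) orbCA. Qed.

Lemma lineality_neg h E S : lineality E (oppform h :: S) = direction (h :: E ++ S).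
Proof.
rewrite lineality_pos; apply/vspaceP => w.
by rewrite !mem_direction_cons oppform1 innerNr oppr_eq0.
Qed.

(* The ordinary Euler characteristic of the intersection with a large closed
   cube: it vanishes unless the recession cone is a linear subspace, and
   equals 1 on a nonempty affine subspace. *)
Definition recession_euler E S : int :=
  (-1) ^+ (\dim (direction E) + \dim (lineality E S))
  *+ (`[< polyhedron E S !=set0 >] && `[< recession_linear E S >]).

Lemma eq_recession_euler E E' S S' : E =i E' -> S =i S' ->
  recession_euler E S = recession_euler E' S'.
Proof.
move=> EE' SS'; rewrite /recession_euler /recession_linear.
rewrite (eq_polyhedron EE' SS') (eq_recession EE' SS') (eq_direction EE').
by rewrite /lineality (@eq_direction _ _ (E ++ S) (E' ++ S')) // => x; rewrite !mem_cat EE' SS'.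
Qed.

(** A recession direction along which [h] decreases would lead out of the half-space, so the new
    inequality does not change the cone. If the cone is linear, [h] is then constant along it and
    the lineality space stays the same. *)
Lemma recession_euler_pos h E S :
  polyhedron E S !=set0 -> polyhedron E S `<=` [set v | h.2 < inner v h.1] ->
  recession_euler E (h :: S) = recession_euler E S.
Proof.
move=> [x xP] hpos; rewrite /recession_euler.
have -> : polyhedron E (h :: S) = polyhedron E S.
  by rewrite polyhedron_pos; apply/setIidPl.
have rech : recession E (h :: S) = recession E S.
  rewrite recession_pos; apply/setIidPl => w wC /=; rewrite leNgt; apply/negP => wh.
  (* The time at which the ray from [x] in direction [w] meets the hyperplane of [h]. *)
  have t0 : 0 <= (inner x h.1 - h.2) / - inner w h.1.
    by rewrite divr_ge0 ?subr_ge0 ?oppr_ge0 ?(ltW wh) // ltW // hpos.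
  have := hpos _ (polyhedron_recession xP wC t0).
  by rewrite /= innerDl innerZl invrN mulrN mulNr divfK ?lt_eqF // opprB addrCA subrr addr0 ltxx.
rewrite /recession_linear rech; case: asboolP => //= _; case: asboolP => //= lin.
rewrite lineality_pos direction_cons_const // => w /mem_lineality [].
rewrite -rech recession_pos => -[_ /= w0] [_ /=]; rewrite innerNl oppr_ge0 => w1.
by apply/eqP; rewrite eq_le w0 w1.
Qed.

(** A positive combination of [w] and [w'] lies where [a] vanishes, hence is invertible in the cone;
    adding a multiple of [w'] to its opposite gives [- w]. *)
Lemma recession_linear_cross a E S w w' :
  (forall u, recession E S u -> inner u a = 0 -> recession E S (- u)) ->
  recession E S w -> recession E S w' -> 0 < inner w a -> inner w' a < 0 ->
  recession E S (- w).
Proof.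
move=> lin wC w'C wa w'a; set t := inner w a / - inner w' a.
have t0 : 0 <= t by apply: divr_ge0; rewrite ?oppr_ge0 ltW.
have uC : recession E S (- (w + t *: w')).
  apply: lin; first exact/recessionD/recessionZ.
  by rewrite innerDl innerZl /t invrN mulrN mulNr divfK ?lt_eqF // subrr.
by rewrite (_ : - w = t *: w' - (w + t *: w')); [exact/recessionD/uC/recessionZ
  |rewrite opprD addrCA subrr addr0].
Qed.

(** In the transversal case let C be the recession cone. If C is linear and [h] vanishes on it, all
    pieces have linear cones and x = x + x - x. If C is linear and [h] does not vanish on it, both
    half-cones are not linear, and on the section the two dimensions drop together, which preserves
    the sign. If C is not linear, either no piece has a linear cone or the section and exactly one
    half do, with opposite signs. *)
Lemma recession_euler_additive h E S :
  recession_euler E S =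
  recession_euler E (h :: S) + recession_euler E (oppform h :: S)
  + recession_euler (h :: E) S.
Proof.
have empty0 E' S' : ~ (polyhedron E' S' !=set0) -> recession_euler E' S' = 0.
  by move=> e; rewrite /recession_euler asboolF.
have [P0|P0] := pselect (polyhedron E S !=set0); last first.
  rewrite !empty0 // => -[v];
    by rewrite ?polyhedron_pos ?polyhedron_neg ?polyhedron_eq => -[vP _]; apply: P0; exists v.
have [|noz] := pselect (polyhedron (h :: E) S !=set0); last first.
  have noz' v : polyhedron E S v -> inner v h.1 <> h.2.
    by move=> vP vh; apply: noz; exists v; rewrite polyhedron_eq.
  rewrite (empty0 (h :: E)) // addr0.
  have [x xP] := P0; case: (ltrgtP (inner x h.1) h.2) => [xh|xh|/noz' //].
    have neg y : polyhedron E S y -> inner y h.1 < h.2.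
      move=> yP; case: (ltrgtP (inner y h.1) h.2) => [//|yh|/noz' //].
      by case: noz; apply: polyhedron_cross xP yP xh yh.
    rewrite (empty0 E (h :: S)) ?add0r; last first.
      by move=> [y]; rewrite polyhedron_pos => -[/neg /= /ltW]; rewrite leNgt => /negP.
    by rewrite recession_euler_pos // => y /neg /=; rewrite oppform1 oppform2 innerNr ltrN2.
  have pos y : polyhedron E S y -> h.2 < inner y h.1.
    move=> yP; case: (ltrgtP (inner y h.1) h.2) => [yh|//|/noz' //].
    by case: noz; apply: polyhedron_cross yP xP yh xh.
  rewrite (empty0 E (oppform h :: S)) ?addr0; last first.
    by move=> [y]; rewrite polyhedron_neg => -[/pos /= /ltW]; rewrite leNgt => /negP.
  by rewrite recession_euler_pos.
move=> [z]; rewrite polyhedron_eq => -[zP zh].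
have [hconst|] := pselect (forall w, w \in direction E -> inner w h.1 = 0).
  have const v : polyhedron E S v -> inner v h.1 = h.2.
    move=> [vE _]; have [zE _] := zP; move: vE; rewrite (sol_direction zE) => -[u uE <-].
    by rewrite innerDl (hconst u) // addr0.
  rewrite /recession_euler /recession_linear (direction_cons_const hconst).
  rewrite polyhedron_eq recession_eq lineality_eq.
  rewrite (setIidPl _ _).2; last by move=> v /const.
  rewrite (setIidPl _ _).2; last by move=> v [/hconst].
  rewrite direction_cons_const; last first.
    by move=> w /mem_lineality[[/hconst]].
  case: (asboolP (polyhedron E (_ :: _) !=set0)) => [[v]|_].
    by rewrite polyhedron_pos => -[/const /= ->]; rewrite ltxx.
  case: (asboolP (polyhedron E (_ :: _) !=set0)) => [[v]|_].
    by rewrite polyhedron_neg => -[/const /= ->]; rewrite ltxx.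
  by rewrite !add0r.
move=> /existsNP[w /not_implyP[wE /eqP wh]].
have [pos neg] := polyhedron_sides zP zh wE wh.
have zero : polyhedron (h :: E) S !=set0 by exists z; rewrite polyhedron_eq.
rewrite /recession_euler (asboolT P0) (asboolT pos) (asboolT neg) (asboolT zero) /=.
rewrite lineality_pos lineality_neg lineality_eq (dim_direction_cons wE wh).
move: (\dim (direction (h :: E))) => d.
have linpos : recession_linear E (h :: S) -> recession_linear (h :: E) S.
  rewrite /recession_linear recession_pos recession_eq => lin u [uC /= uh].
  have [|uC' _] := lin u; first by split=> //=; rewrite uh.
  by split=> //=; rewrite innerNl uh oppr0.
have linneg : recession_linear E (oppform h :: S) -> recession_linear (h :: E) S.
  rewrite /recession_linear recession_neg recession_eq => lin u [uC /= uh].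
  have [|uC' _] := lin u; first by split=> //=; rewrite uh.
  by split=> //=; rewrite innerNl uh oppr0.
have [lin|nlin] := asboolP (recession_linear E S) => /=.
  have linz : recession_linear (h :: E) S.
    rewrite /recession_linear recession_eq => u [/lin uC /= uh]; split=> //=.
    by rewrite innerNl uh oppr0.
  rewrite (asboolT linz).
  have [hL|] := pselect (forall u, u \in lineality E S -> inner u h.1 = 0).
    have Ch u : recession E S u -> inner u h.1 = 0.
      by move=> uC; apply: hL; apply/mem_lineality; split=> //; apply: lin.
    have linp : recession_linear E (h :: S).
      rewrite /recession_linear recession_pos => u [/lin uC /= uh]; split=> //=.
      by rewrite (Ch _ uC).
    have linn : recession_linear E (oppform h :: S).
      rewrite /recession_linear recession_neg => u [/lin uC /= uh]; split=> //=.
      by rewrite (Ch _ uC).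
    rewrite (asboolT linp) (asboolT linn) direction_cons_const //.
    rewrite /lineality; move: (\dim _) => l; rewrite addSn exprS /= !mulr1n; ring.
  move=> /existsNP[u /not_implyP[uL /eqP uh]].
  rewrite (@dim_direction_cons _ _ h (E ++ S) u) //.
  have [u' u'C u'h] : exists2 u', recession E S u' & 0 < inner u' h.1.
    move/mem_lineality: uL => [uC uC'].
    move: uh; rewrite neq_lt => /orP[uh|uh]; last by exists u.
    by exists (- u) => //; rewrite innerNl oppr_gt0.
  rewrite !asboolF /=.
  - move: (\dim _) => l; rewrite addSn addnS !exprS /= ?mulr1n ?mulr0n; ring.
  - rewrite /recession_linear recession_neg => lin'.
    have [|_ /=] := lin' (- u'); first by split; [apply: lin|rewrite /= innerNl oppr_le0 ltW].
    by rewrite opprK leNgt u'h.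
  rewrite /recession_linear recession_pos => lin'.
  have [|_ /=] := lin' u'; first by split=> //=; rewrite ltW.
  by rewrite innerNl oppr_ge0 leNgt u'h.
rewrite mulr0n; have [linz|nlinz] := asboolP (recession_linear (h :: E) S) => /=; last first.
  by rewrite !asboolF //; [move/linneg|move/linpos].
have [linp|nlinp] := asboolP (recession_linear E (h :: S)) => /=;
have [linn|nlinn] := asboolP (recession_linear E (oppform h :: S)) => /=.
- case: nlin => u uC; move: linp linn.
  rewrite /recession_linear recession_pos recession_neg => linp linn.
  by case: (lerP 0 (inner u h.1)) => [uh|/ltW uh]; [case: (linp u)|case: (linn u)].
- by move: (\dim _) => l; rewrite addSn exprS /= ?mulr1n ?mulr0n; ring.
- by move: (\dim _) => l; rewrite addSn exprS /= ?mulr1n ?mulr0n; ring.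
(* If neither half is linear, C has vectors strictly on both sides of [h]; [recession_linear_cross]
   then makes C linear, a contradiction. *)
case: nlin => v vC.
have linz0 u : recession E S u -> inner u h.1 = 0 -> recession E S (- u).
  by move=> uC uh; have := linz u; rewrite recession_eq => -[].
have [u uC uh] : exists2 u, recession E S u & 0 < inner u h.1.
  apply/not_exists2P => none; apply: nlinp; rewrite /recession_linear recession_pos => u [uC /= uh].
  have u0 : inner u h.1 = 0.
    by apply/eqP; rewrite eq_le uh andbT leNgt; apply/negP => up; case: (none u).
  by split; [exact: linz0|rewrite /= innerNl u0 oppr0].
have [u' u'C u'h] : exists2 u, recession E S u & inner u h.1 < 0.
  apply/not_exists2P => none; apply: nlinn; rewrite /recession_linear recession_neg => u' [u'C /= u'h].
  have u0 : inner u' h.1 = 0.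
    by apply/eqP; rewrite eq_le u'h leNgt; apply/negP => up; case: (none u').
  by split; [exact: linz0|rewrite /= innerNl u0 oppr0].
have [vh|vh|vh] := ltrgtP (inner v h.1) 0.
- apply: (@recession_linear_cross (- h.1) _ _ _ u) => //.
  + by move=> v' v'C; rewrite innerNr => /eqP; rewrite oppr_eq0 => /eqP; apply: linz0.
  + by rewrite innerNr oppr_gt0.
  + by rewrite innerNr oppr_lt0.
- exact: (recession_linear_cross linz0 vC u'C).
- exact: linz0.
Qed.

End RecessionEuler.

(** * Regions and Zaslavsky's theorems *)

Section Leaves.
Variables (R : realType) (n : nat).
Local Notation V := 'rV[R]_n.
Local Notation form := ('rV[R]_n * R)%type.
Implicit Types (h : form) (A S T : seq form) (u v w : V).

Fixpoint leaves S A : seq (seq form) :=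
  if A is h :: A' then leaves (h :: S) A' ++ leaves (oppform h :: S) A' else [:: S].

Lemma leaves_sub S A T : T \in leaves S A -> {subset S <= T}.
Proof.
elim: A S => [|h A IH] S /=; first by rewrite inE => /eqP->.
by rewrite mem_cat => /orP[] /IH sub x xS; apply: sub; rewrite inE xS orbT.
Qed.

Lemma leaves_decide S A T h : T \in leaves S A -> h \in A ->
  h \in T \/ oppform h \in T.
Proof.
elim: A S => //= g A IH S; rewrite mem_cat inE => /orP[] TA /orP[/eqP->|hA].
- by left; apply: (leaves_sub TA); rewrite mem_head.
- exact: IH TA hA.
- by right; apply: (leaves_sub TA); rewrite mem_head.
- exact: IH TA hA.
Qed.

Lemma leaves_mem S A T s : T \in leaves S A -> s \in T ->
  s \in S \/ exists2 h, h \in A & s = h \/ s = oppform h.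
Proof.
elim: A S => [|g A IH] S /=; first by rewrite inE => /eqP->; left.
rewrite mem_cat => /orP[] /IH H /H; rewrite inE => -[/orP[/eqP->|]|[h hA sh]].
- by right; exists g; [rewrite mem_head|left].
- by left.
- by right; exists h; rewrite // inE hA orbT.
- by right; exists g; [rewrite mem_head|right].
- by left.
- by right; exists h; rewrite // inE hA orbT.
Qed.

Lemma polyhedron_sub S T : {subset S <= T} ->
  polyhedron [::] T `<=` polyhedron [::] S.
Proof. by move=> sub v [vE vT]; split=> // s /sub; apply: vT. Qed.

Lemma leaves_cover S A v : polyhedron [::] S v ->
  (forall h, h \in A -> inner v h.1 != h.2) ->
  exists2 T, T \in leaves S A & polyhedron [::] T v.
Proof.
elim: A S => [|h A IH] S vS vA /=; first by exists S; rewrite ?mem_head.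
have vA' g : g \in A -> inner v g.1 != g.2 by move=> gA; apply: vA; rewrite inE gA orbT.
case: (ltrgtP (inner v h.1) h.2) (vA h (mem_head _ _)) => // vh _.
  have [|T TA vT] := IH (oppform h :: S) _ vA'; first by rewrite polyhedron_neg.
  by exists T; rewrite // mem_cat TA orbT.
have [|T TA vT] := IH (h :: S) _ vA'; first by rewrite polyhedron_pos.
by exists T; rewrite // mem_cat TA.
Qed.

Lemma leaves_avoid S A T v h : T \in leaves S A -> polyhedron [::] T v -> h \in A ->
  inner v h.1 != h.2.
Proof.
move=> TA [_ vT] /(leaves_decide TA)[] /vT /=; first by move/gt_eqF->.
by rewrite oppform1 oppform2 innerNr ltrN2 => /lt_eqF->.
Qed.

(** [Q] will be the trivial condition for all regions and boundedness for the bounded ones. *)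
Variable Q : set V -> Prop.

Definition cells S A : set (set V) :=
  [set P | exists2 T, T \in leaves S A &
     [/\ P = polyhedron [::] T, P !=set0 & Q P]].

Definition cell_indicator T : int :=
  (`[< polyhedron [::] T !=set0 /\ Q (polyhedron [::] T) >])%:R.

Lemma card_cells S A :
  finite_set (cells S A) /\
  (#|` fset_set (cells S A)|)%:Z = cellsum (@oppform R n) cell_indicator S A.
Proof.
elim: A S => [|h A IH] S /=.
  rewrite /cell_indicator.
  have -> : cells S [::] = if `[< polyhedron [::] S !=set0 /\ Q (polyhedron [::] S) >]
                           then [set polyhedron [::] S] else set0.
    apply/seteqP; split => P.
      by move=> [T]; rewrite inE => /eqP-> [-> ? ?]; rewrite asboolT.
    by case: asboolP => // -[? ?] ->; exists S; rewrite ?mem_head.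
  case: asboolP => _ /=; first by split; [exact: finite_set1|rewrite fset_set1 cardfs1].
  by split; [exact: finite_set0|rewrite fset_set0 cardfs0].
have [fin1 card1] := IH (h :: S); have [fin2 card2] := IH (oppform h :: S).
have -> : cells S (h :: A) = cells (h :: S) A `|` cells (oppform h :: S) A.
  apply/seteqP; split => P.
    by move=> [T] /=; rewrite mem_cat => /orP[] TA TP; [left|right]; exists T.
  by move=> [] [T TA TP]; exists T; rewrite //= mem_cat TA ?orbT.
split; first by rewrite finite_setU.
rewrite fset_setU // cardfsU -card1 -card2 [X in (_ - X)%N](_ : _ = 0%N).
  by rewrite subn0 PoszD.
(* A common cell would be a nonempty set on which [h] is both positive and negative. *)
apply/eqP; rewrite cardfs_eq0; apply/eqP/fsetP => P.
rewrite in_fsetI !in_fset_set // in_fset0; apply/negP => /andP[]; rewrite !inE.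
move=> [T1 T1A [PT1 [v vP] _]] [T2 T2A [PT2 _ _]].
move: (vP); rewrite PT1 => /(polyhedron_sub (leaves_sub T1A)).
rewrite polyhedron_pos => -[_ /= vh].
move: (vP); rewrite PT2 => /(polyhedron_sub (leaves_sub T2A)).
by rewrite polyhedron_neg => -[_ /= /(lt_trans vh)]; rewrite ltxx.
Qed.

End Leaves.

Section Regions.
Variables (R : realType) (n : nat).
Local Notation V := 'rV[R]_n.
Local Notation form := ('rV[R]_n * R)%type.
Implicit Types (h : form) (A S T : seq form) (u v w : V).

Lemma inner_continuous w : continuous (fun v : V => inner v w).
Proof.
rewrite (_ : (fun v => _) = \sum_(i < n) (fun v : V => v ord0 i * w 0 i)).
  apply: (big_ind (fun f : V -> R => continuous f)).
  - exact: (@cst_continuous V R 0).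
  - by move=> f g cf cg v; apply: continuousD; [exact: cf|exact: cg].
  - move=> i _ v; apply: continuousM; last exact: cst_continuous.
    exact: coord_continuous.
by apply/funext => v; rewrite fct_sumE.
Qed.

Lemma polyhedron_connected T : connected (polyhedron [::] T : set V).
Proof.
have [->|/set0P[x xT]] := eqVneq (polyhedron [::] T : set V) set0; first exact: connected0.
pose seg y : set V := (fun t : R => x + t *: (y - x)) @` `[0, 1].
have -> : polyhedron [::] T = \bigcup_(y in polyhedron [::] T) seg y.
  apply/seteqP; split => y.
    move=> yT; exists y => //; exists 1; last by rewrite scale1r addrC subrK.
    by rewrite /= in_itv /= ler01 lexx.
  by move=> [z zT [t /=]]; rewrite in_itv /= => t01 <-; exact: polyhedron_convex.
apply: bigcup_connected.
  exists x => y _; exists 0; last by rewrite scale0r addr0.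
  by rewrite /= in_itv /= ler01 lexx.
move=> y _; apply: connected_continuous_connected; first exact: segment_connected.
apply: continuous_subspaceT => t.
have := @continuousD _ V R (cst x) (fun t => t *: (y - x)) t.
by apply; [exact: cst_continuous|exact: scalel_continuous].
Qed.

(** The cell is convex, hence connected. Conversely, a point of the component on the wrong side of
    some [s] would, by the intermediate value theorem, force the component to meet the hyperplane of
    [s]. *)
Lemma connected_component_leaf A T v : T \in leaves [::] A -> polyhedron [::] T v ->
  connected_component (complement (arrangement A)) v = polyhedron [::] T.
Proof.
move=> TA vT; apply/seteqP; split; last first.
  apply: connected_component_max => //; last exact: polyhedron_connected.
  move=> u uT [_ [h hA ->]]; rewrite /hyperplane /= => /eqP.
  by rewrite (negPf (leaves_avoid TA uT hA)).
move=> u uC; split=> [e //|s sT] /=; rewrite ltNge; apply/negP => us.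
set C := connected_component _ v in uC.
have Cc : connected ((fun v => inner v s.1) @` C).
  apply: connected_continuous_connected; first exact: component_connected.
  exact/continuous_subspaceT/inner_continuous.
have vC : C v.
  apply: connected_component_refl => -[_ [h hA ->]]; rewrite /hyperplane /= => /eqP.
  by rewrite (negPf (leaves_avoid TA vT hA)).
have [w wC ws] : ((fun v => inner v s.1) @` C) s.2.
  move/connected_intervalP: Cc => /(_ (inner u s.1) (inner v s.1)); apply.
  - by exists u.
  - by exists v.
  - by rewrite us ltW // vT.2.
apply: (connected_component_sub wC); exists (hyperplane s.1 s.2) => //.
have [//|[h hA [->|->]]] := leaves_mem TA sT; exists h => //.
apply/funext => z; apply/propext; rewrite /hyperplane /= oppform1 oppform2 innerNr.
by split=> [/oppr_inj|->].
Qed.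

Lemma regions_cells A Q : regions (arrangement A) `&` Q = cells Q [::] A.
Proof.
apply/seteqP; split => P.
  move=> [[v vA <-] PQ].
  have [T TA vT] : exists2 T, T \in leaves [::] A & polyhedron [::] T v.
    apply: leaves_cover => [|h hA]; first by split.
    by apply/eqP => vh; apply: vA; exists (hyperplane h.1 h.2) => //; exists h.
  rewrite (connected_component_leaf TA vT) in PQ *.
  by exists T => //; split=> //; exists v.
move=> [T TA [PT [v vP] PQ]]; split=> //; exists v.
  move=> [_ [h hA ->]]; rewrite /hyperplane /= => /eqP.
  by rewrite PT in vP; rewrite (negPf (leaves_avoid TA vP hA)).
by rewrite PT in vP *; exact: connected_component_leaf.
Qed.

End Regions.

(** * A nonempty cell is bounded if and only if its recession cone is trivial *)

Section Bounded.
Variables (R : realType) (n : nat).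
Local Notation V := 'rV[R]_n.
Local Notation form := ('rV[R]_n * R)%type.
Implicit Types (h : form) (A S T : seq form) (u v w : V).

Lemma bounded_recession_trivial T w : bounded_set (polyhedron [::] T : set V) ->
  polyhedron [::] T !=set0 -> recession [::] T w -> w = 0.
Proof.
move=> bT [x xT] wC; apply/eqP/negPn/negP => w0.
have [M M0 xM] := ex_strict_bound_gt0 bT.
have w_gt0 : 0 < `|w| by rewrite normr_gt0.
(* This multiple of [w] has norm [M + |x|], so the translate of [x] by it has norm at least [M]. *)
have t0 : 0 <= (M + `|x|) / `|w| by rewrite divr_ge0 ?addr_ge0 // ltW.
have /= := xM _ (polyhedron_recession xT wC t0); rewrite ltNge => /negP[].
have := ler_normB (x + ((M + `|x|) / `|w|) *: w) x.
rewrite addrAC subrr add0r normrZ ger0_norm // divfK ?gt_eqF // => le.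
lra.
Qed.

(* On the unit sphere this is positive, hence bounded below, when no direction
   is a recession direction. *)
Definition negative_part T u : R := \sum_(s <- T) (`|inner u s.1| - inner u s.1).

Lemma negative_part_continuous T : continuous (negative_part T).
Proof.
rewrite (_ : negative_part T = \sum_(s <- T) (fun u => `|inner u s.1| - inner u s.1)).
  apply: (big_ind (fun f : V -> R => continuous f)).
  - exact: (@cst_continuous V R 0).
  - by move=> f g cf cg v; apply: continuousD; [exact: cf|exact: cg].
  - move=> s _ v.
    have := @continuousD _ R^o V (fun u : V => `|inner u s.1|) (fun u : V => - inner u s.1) v.
    apply.
      apply: (@continuous_comp _ _ _ (fun u : V => inner u s.1) (fun r : R => `|r|)).
        exact: inner_continuous.
      exact: norm_continuous.
    by apply: continuousN; exact: inner_continuous.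
by apply/funext => v; rewrite fct_sumE.
Qed.

Lemma negative_partZ T t u : 0 <= t -> negative_part T (t *: u) = t * negative_part T u.
Proof.
move=> t0; rewrite /negative_part mulr_sumr; apply: eq_bigr => s _.
by rewrite innerZl normrM (ger0_norm t0) mulrBr.
Qed.

(** By compactness of the sphere and homogeneity, [negative_part] grows at least linearly with the
    norm; on the differences [v - x0] of points of the cell it is bounded by the inequalities. *)
Lemma recession_trivial_bounded T :
  (forall w, recession [::] T w -> w = 0) -> bounded_set (polyhedron [::] T : set V).
Proof.
move=> rec0; have [->|/set0P[x0 x0T]] := eqVneq (polyhedron [::] T : set V) set0.
  by exists 0; split=> // M _ v.
pose K : set V := [set u | `|u| = 1].
have Kc : compact K.
  apply: bounded_closed_compact.
    by exists 1; split=> // M M1 u; rewrite /K /= => ->; exact: ltW.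
  apply: (@closed_comp _ _ (fun u : V => `|u|) [set 1]); last exact: closed_eq.
  by move=> u _; exact: norm_continuous.
have [d d0 dK] : exists2 d, 0 < d & forall u, K u -> d <= negative_part T u.
  (* The sphere is empty when the space is 0. *)
  have [->|/set0P K0] := eqVneq K set0; first by exists 1.
  have [|c cK cmin] := compact_EVT_min K0 Kc (f := negative_part T).
    exact/continuous_subspaceT/negative_part_continuous.
  exists (negative_part T c); last by move=> u uK; apply: cmin; rewrite inE.
  rewrite lt_neqAle eq_sym; apply/andP; split; last first.
    by apply: sumr_ge0 => s _; rewrite subr_ge0 ler_norm.
  apply/eqP => c0; move: cK; rewrite inE /K /= => /eqP; rewrite (rec0 c) ?normr0 1?eq_sym ?oner_eq0 //.
  split; first by rewrite memvf.
  move=> s sT; move/eqP: c0; rewrite psumr_eq0; last by move=> *; rewrite subr_ge0 ler_norm.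
  by move=> /allP /(_ _ sT) /=; rewrite subr_eq0 => /eqP <-.
(* The factor 2 comes from |r| - r being twice the negative part of r. *)
pose B := \sum_(s <- T) 2 * (inner x0 s.1 - s.2).
have bnd v : polyhedron [::] T v -> `|v - x0| <= B / d.
  move=> vT; have [->|nz] := eqVneq (v - x0) 0.
    rewrite normr0 divr_ge0 ?(ltW d0) // /B big_seq; apply: sumr_ge0 => s sT.
    by rewrite mulr_ge0 // subr_ge0 ltW // x0T.2.
  have pos : 0 < `|v - x0| by rewrite normr_gt0.
  rewrite ler_pdivlMr //.
  have : negative_part T (v - x0) <= B.
    rewrite /negative_part /B !big_seq; apply: ler_sum => s sT.
    have := vT.2 _ sT; have := x0T.2 _ sT; rewrite /= innerBl.
    set a := inner v _; set b := inner x0 _ => sb sa.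
    by case: (ger0P (a - b)) => _; lra.
  apply: le_trans.
  have E : v - x0 = `|v - x0| *: (`|v - x0|^-1 *: (v - x0)).
    by rewrite scalerA divff ?scale1r // gt_eqF.
  rewrite [X in negative_part T X]E negative_partZ ?(ltW pos) // ler_wpM2l ?(ltW pos) // dK //.
  by rewrite /K /= normrZ normfV normr_id mulVf // gt_eqF.
exists (B / d + `|x0|); split=> [|M BM v vT]; first exact: num_real.
apply: le_trans (ltW BM); rewrite -lerBlDr; apply: le_trans (bnd _ vT).
exact: lerB_dist.
Qed.

End Bounded.

Lemma cellsum_leaves (R : realType) (n : nat) (f : seq ('rV[R]_n * R) -> int) S A :
  cellsum (@oppform R n) f S A = \sum_(T <- leaves S A) f T.
Proof. by elim: A S => [|h A IH] S /=; rewrite ?big_seq1 // big_cat !IH. Qed.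

Lemma dimvf_rV (R : realType) (n : nat) : \dim {: 'rV[R]_n} = n.
Proof. by rewrite dimvf dim_matrix; exact: mul1n. Qed.

Section Zaslavsky.
Variables (R : realType) (n : nat) (A : seq ('rV[R]_n * R)).
Hypothesis A_proper : forall h, h \in A -> h.1 != 0.
Local Notation V := 'rV[R]_n.
Local Notation chi := (arr_poly (arrangement A)).

Lemma card_cells_N Q N :
  cellsum (@oppform R n) (cell_indicator Q) [::] A = N%:Z ->
  (regions (arrangement A) `&` Q #= `I_N)%card.
Proof.
rewrite regions_cells; have [fin <-] := card_cells Q [::] A => -[<-].
rewrite -[X in (X #= _)%card](fset_setK fin); exact/card_eq_fsetP.
Qed.

Lemma polyhedron_nil (E : seq ('rV[R]_n * R)) : polyhedron E [::] = sol E.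
Proof. by apply/seteqP; split => [v []//|v vE]; split. Qed.

Lemma horner_chi (x : int) : chi.[x] = altsum (fun E => (@solpoly R n E).[x]) [::] A.
Proof. by rewrite arr_poly_altsum // -horner_evalE raddf_altsum. Qed.

Theorem zaslavsky_regions N :
  chi.[-1] = (-1) ^+ n * N%:Z -> (regions (arrangement A) #= `I_N)%card.
Proof.
rewrite horner_chi => chiE; rewrite -[X in (X #= _)%card]setIT; apply: card_cells_N.
have sgn0 : (-1) ^+ n != 0 :> int by rewrite signr_eq0.
apply: (mulfI sgn0); rewrite -chiE.
rewrite (@eq_altsum _ _ _ (fun E => euler E [::])); last first.
  move=> E; rewrite /solpoly /euler polyhedron_nil; case: asboolP => _ /=.
    by rewrite hornerXn.
  by rewrite horner0.
rewrite (altsum_cellsum (opp := @oppform R n)).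
- rewrite !cellsum_leaves mulr_sumr; apply: eq_bigr => T _.
  rewrite /cell_indicator /euler /direction /= dimvf_rV -[RHS]mulr_natr.
  by congr (_ * _%:R); congr nat_of_bool; congr asbool; apply/propext; split=> [[]|]//.
- by move=> E S S' SS'; rewrite /euler (@eq_polyhedron _ _ E E S S').
- by move=> h E S _; exact: euler_additive.
Qed.

(** Essentiality makes the lineality space of every open cell 0. The recession cone of a nonempty
    cell is then linear only if it is 0, that is, if the cell is bounded. *)
Theorem zaslavsky_bounded N :
  (forall w, (forall h, h \in A -> inner w h.1 = 0) -> w = 0) ->
  chi.[1] = (-1) ^+ n * N%:Z -> (bounded_regions (arrangement A) #= `I_N)%card.
Proof.
move=> essential; rewrite horner_chi => chiE; apply: card_cells_N.
have sgn0 : (-1) ^+ n != 0 :> int by rewrite signr_eq0.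
apply: (mulfI sgn0); rewrite -chiE.
rewrite (@eq_altsum _ _ _ (fun E => recession_euler E [::])); last first.
  move=> E; rewrite /solpoly /recession_euler polyhedron_nil; case: asboolP => _ /=.
    (* Without inequalities the lineality space is the whole direction, so the exponent is even and
       the value is 1. *)
    rewrite hornerXn expr1n asboolT; last first.
      by move=> w [wE _]; split=> //; rewrite memvN.
    by rewrite /lineality cats0 addnn -mul2n exprM sqrrN !expr1n.
  by rewrite horner0.
rewrite (altsum_cellsum (opp := @oppform R n)); first last.
- by move=> h E S _; exact: recession_euler_additive.
- by move=> E S S' SS'; exact: eq_recession_euler.
rewrite !cellsum_leaves mulr_sumr !big_seq; apply: eq_bigr => T TA.
have lin0 : lineality [::] T = 0%VS.
  apply/eqP; rewrite -subv0; apply/subvP => w /mem_direction wT.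
  rewrite memv0; apply/eqP/essential => h hA.
  have [/wT //|/wT] := leaves_decide TA hA.
  by rewrite oppform1 innerNr => /eqP; rewrite oppr_eq0 => /eqP.
rewrite /cell_indicator /recession_euler lin0 dimv0 addn0 /direction /= dimvf_rV -[RHS]mulr_natr.
congr (_ * _%:R); congr nat_of_bool; rewrite -asbool_and; congr asbool.
apply/propext; split=> -[T0 H]; split=> //.
  move=> w wC; have -> : w = 0; last by rewrite oppr0; split; rewrite ?memvf // => s sT; rewrite inner0l.
  exact: bounded_recession_trivial wC.
apply: recession_trivial_bounded => w wC; apply/eqP; rewrite -memv0 -lin0.
by apply/mem_lineality; split=> //; apply: H.
Qed.

End Zaslavsky.

(** * The finite field method *)

(** The unimodular factors of the Smith normal form stay invertible over [K], so the rank is the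
    number of invariant factors that survive in [K]. [N] is the product of the nonzero ones. *)
Lemma rank_map_intr m n (M : 'M[int]_(m, n)) :
  exists r N, (0 < N)%N /\
    forall K : fieldType, N%:R != 0 :> K -> \rank (map_mx (intr : int -> K) M) = r.
Proof.
have [L Lu [Rm Ru [d d_sorted ->]]] := int_Smith_normal_form M.
(* By divisibility the zero invariant factors come last, and [k] is the index of the first. *)
pose k := find (pred1 0) d.
have d_zero i : (i < k)%N = (d`_i != 0).
  case: (ltnP i k) => [ik|ki].
    by have /negbT := before_find 0 ik.
  have [id|di] := ltnP i (size d); last by rewrite nth_default.
  have kd : (k < size d)%N by apply: leq_ltn_trans id.
  have dk0 : d`_k == 0 by apply: (@nth_find _ 0 (pred1 0) d); rewrite has_find.
  have := sorted_leq_nth (fun _ _ _ => @dvdz_trans _ _ _) dvdzz 0 d_sorted.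
  move=> /(_ k i); rewrite !inE => /(_ kd id ki).
  by rewrite (eqP dk0) dvd0z => ->.
exists (minn k (minn m n)), (\prod_(i < k) absz (d`_i)%R)%N; split.
  by apply: prodn_gt0 => i; rewrite absz_gt0 -d_zero.
move=> K NK.
have dK i : (i < k)%N -> (d`_i)%:~R != 0 :> K.
  move=> ik; apply: contraNneq NK => dK.
  rewrite natr_prod (bigD1 (Ordinal ik)) //= -[_%:R]/(Posz (absz d`_i))%:~R abszE.
  have [|] := lerP 0 d`_i => s; rewrite ?(ger0_norm s) ?(ltr0_norm s) ?rmorphN /= dK ?oppr0 mul0r //.
rewrite !map_mxM.
have unit_map p (U : 'M[int]_p) : U \in unitmx -> map_mx (intr : int -> K) U \in unitmx.
  by rewrite !unitmxE det_map_mx; apply: rmorph_unit.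
have L_full : row_full (map_mx (intr : int -> K) L) by rewrite row_full_unit unit_map.
rewrite mxrankMfree ?row_free_unit ?unit_map // (eqmxMfull _ L_full).
(* Padding with 1 makes this diagonal matrix invertible, leaving a partial identity of known
   rank. *)
pose e : 'rV[K]_m := \row_i (if (i < k)%N then (d`_i)%:~R else 1).
have -> : map_mx (intr : int -> K) (\matrix_(i, j) (d`_i *+ (i == j :> nat)))
    = diag_mx e *m (pid_mx (minn k (minn m n)) : 'M[K]_(m, n)).
  apply/matrixP => i j; rewrite mul_diag_mx !mxE.
  have [ij|_] := eqVneq (i : nat) j; last by rewrite mulr0n mulr0 rmorph0.
  have jn : (i < n)%N by rewrite ij.
  rewrite !leq_min ltn_ord jn !andbT /=.
  case: ltnP => [ik|ki]; first by rewrite mulr1n mulr1.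
  by rewrite mulr0 mulr1n; move: ki; rewrite leqNgt d_zero negbK => /eqP->.
have e_full : row_full (diag_mx e).
  rewrite row_full_unit unitmxE det_diag unitfE; apply/prodf_neq0 => i _.
  by rewrite mxE; case: ifP => [/dK|]; rewrite ?oner_eq0.
rewrite (eqmxMfull _ e_full) rank_pid_mx // geq_min geq_min.
  by rewrite leqnn orbT.
by rewrite leqnn !orbT.
Qed.

Section LinearSystems.
Variables (K : fieldType) (n m : nat) (M : 'M[K]_(n, m)) (c : 'rV[K]_m).

(** The Rouché-Capelli criterion: appending [c] keeps the rank exactly when [c] lies in the row
    space. *)
Lemma solvable_rank : (exists x, x *m M = c) <-> \rank (col_mx c M) = \rank M.
Proof.
have le : (M <= col_mx c M)%MS by rewrite -addsmxE addsmxSr.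
have := mxrank_leqif_sup le => /leqifP.
have -> : (col_mx c M <= M)%MS = (c <= M)%MS by rewrite col_mx_sub submx_refl andbT.
case: submxP => [[x ->] /eqP eqr|nsol lt]; split=> //; first by exists x.
  by move=> [x xM]; case: nsol; exists x.
by move=> eqr; move: lt; rewrite eqr ltnn.
Qed.

End LinearSystems.

Lemma card_solutions (F : finFieldType) n m (M : 'M[F]_(n, m)) (c : 'rV[F]_m) :
  #|[set x | x *m M == c]%SET|
  = if \rank (col_mx c M) == \rank M then (#|F| ^ (n - \rank M))%N else 0%N.
Proof.
case: eqP => [/solvable_rank[x0 x0M]|nsol]; last first.
  apply/eqP; rewrite cards_eq0; apply/eqP/setP => x; rewrite !inE.
  by apply/eqP => xM; apply: nsol; apply/solvable_rank; exists x.
pose B := row_base (kermx M).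
have -> : [set x | x *m M == c]%SET
   = [set x0 + y *m B | y in [set: 'rV[F]_(\rank (kermx M))]]%SET.
  apply/setP => x; rewrite inE; apply/eqP/imsetP => [xM|[y _ ->]].
    have : (x - x0 <= kermx M)%MS by apply/sub_kermxP; rewrite mulmxBl xM x0M subrr.
    rewrite -(eq_row_base (kermx M)) => /submxP[y yE].
    by exists y; rewrite ?inE // /B -yE addrC subrK.
  rewrite mulmxDl x0M -mulmxA (_ : B *m M = 0) ?mulmx0 ?addr0 //.
  by apply/sub_kermxP; rewrite eq_row_base.
rewrite card_imset ?cardsT ?card_mx ?mul1n ?mxrank_ker //.
by move=> y1 y2 /addrI /(row_free_inj (row_base_free _)).
Qed.

Lemma dimv_rowspace (K : fieldType) n m (U : {vspace 'rV[K]_n}) (N : 'M[K]_(m, n)) :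
  (forall w, (w \in U) = (w <= N)%MS) -> \dim U = \rank N.
Proof.
move=> UN; pose f : 'Hom('rV[K]_(\rank N), 'rV[K]_n) := linfun (mulmxr (row_base N)).
have -> : U = limg f.
  apply/vspaceP => w; rewrite UN -(eq_row_base N); apply/submxP/memv_imgP.
    by move=> [y ->]; exists y; rewrite ?memvf // lfunE.
  by move=> [y _ ->]; exists y; rewrite lfunE.
rewrite limg_dim_eq; first by rewrite dimvf dim_matrix; exact: mul1n.
apply/eqP; rewrite -subv0; apply/subvP => y; rewrite memv_cap memv_ker lfunE /= => /andP[_ /eqP].
rewrite -[RHS](mul0mx 1 (row_base N)) => /(row_free_inj (row_base_free _)) ->.
by rewrite mem0v.
Qed.

Section FiniteField.
Variables (R : realType) (n : nat).
Local Notation iform := ('rV[int]_n * int)%type.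
Implicit Types (h : iform) (E A : seq iform).

Definition real_form h : 'rV[R]_n * R := (map_mx intr h.1, h.2%:~R).

Definition on_form (K : ringType) (x : 'rV[K]_n) h : bool :=
  \sum_(i < n) x 0 i * (h.1 0 i)%:~R == h.2%:~R.

Definition coef_mx E : 'M[int]_(n, size E) :=
  \matrix_(i, j) (tnth (in_tuple E) j).1 0 i.

Definition const_row E : 'rV[int]_(size E) := \row_j (tnth (in_tuple E) j).2.

Lemma on_form_mx (K : fieldType) (x : 'rV[K]_n) E :
  all (on_form x) E = (x *m map_mx intr (coef_mx E) == map_mx intr (const_row E)).
Proof.
rewrite -[all _ E]/(all (on_form x) (in_tuple E)).
apply/all_tnthP/eqP => [xE|/rowP xE j].
  apply/rowP => j; rewrite !mxE -(eqP (xE j)); apply: eq_bigr => i _.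
  by rewrite !mxE.
apply/eqP; move: (xE j); rewrite !mxE => <-; apply: eq_bigr => i _.
by rewrite !mxE.
Qed.

Lemma card_on_form (F : finFieldType) E A :
  (#|[set x : 'rV[F]_n | all (on_form x) E && all (fun h => ~~ on_form x h) A]%SET|)%:Z
  = altsum (fun E => (#|[set x : 'rV[F]_n | all (on_form x) E]%SET|)%:Z) E A.
Proof.
elim: A E => [|h A IH] E /=.
  by congr (Posz _); apply: eq_card => x; rewrite !inE andbT.
rewrite -!IH; apply/eqP; rewrite eq_sym subr_eq -PoszD; apply/eqP; congr Posz.
rewrite -(cardsID [set x | on_form x h]%SET [set x | all _ E && all _ A]%SET) addnC.
by congr (_ + _)%N; apply: eq_card => x; rewrite !inE /=;
   case: (on_form x h); case: (all _ E); case: (all _ A).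
Qed.

Lemma inner_real_form (x : 'rV[R]_n) h :
  (inner x (real_form h).1 == (real_form h).2) = on_form x h.
Proof. by rewrite /on_form /inner; under eq_bigr do rewrite mxE. Qed.

Lemma sol_real_form E x : sol (map real_form E) x <-> all (on_form x) E.
Proof.
split=> [xE|/allP xE _ /mapP[h hE ->]]; last by apply/eqP; rewrite inner_real_form xE.
by apply/allP => h hE; rewrite -inner_real_form; apply/eqP/xE/map_f.
Qed.

Lemma dim_direction_real_form E :
  \dim (direction (map real_form E)) = (n - \rank (map_mx (intr : int -> R) (coef_mx E)))%N.
Proof.
rewrite -mxrank_ker; apply: dimv_rowspace => w.
apply/mem_direction/sub_kermxP => [wE|/rowP wE _ /mapP[h hE ->]].
  apply/rowP => j; rewrite !mxE -[RHS](wE (real_form (tnth (in_tuple E) j))).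
    by apply: eq_bigr => i _; rewrite !mxE.
  exact/map_f/mem_tnth.
have /tnthP[j ->] : h \in in_tuple E by [].
by move: (wE j); rewrite !mxE => <-; apply: eq_bigr => i _; rewrite !mxE.
Qed.

Lemma natr_Fp_neq0 q N : prime q -> (0 < N < q)%N -> N%:R != 0 :> 'F_q.
Proof.
move=> q_pr /andP[N0 Nq]; rewrite -(dvdn_pcharf (pchar_Fp q_pr)).
by rewrite gtnNdvd.
Qed.

(** Solvability and dimension depend only on the ranks of the coefficient matrix and of the
    augmented matrix. Beyond both bounds of [rank_map_intr] these agree over R and modulo q. *)
Lemma card_sol_solpoly E : exists Q, forall q, prime q -> (Q < q)%N ->
  (#|[set x : 'rV['F_q]_n | all (on_form x) E]%SET|)%:Z
  = (solpoly (map real_form E)).[q%:Z].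
Proof.
have [r1 [N1 [N1_gt0 rank1]]] := rank_map_intr (coef_mx E).
have [r2 [N2 [N2_gt0 rank2]]] := rank_map_intr (col_mx (const_row E) (coef_mx E)).
exists (maxn N1 N2) => q q_pr; rewrite gtn_max => /andP[N1q N2q].
under eq_finset do rewrite on_form_mx.
rewrite card_solutions -map_col_mx rank1 ?rank2 ?natr_Fp_neq0 ?N1_gt0 ?N2_gt0 //.
rewrite card_Fp // /solpoly dim_direction_real_form rank1 ?pnatr_eq0 -?lt0n //.
have solE : sol (map real_form E) !=set0 <-> r2 = r1.
  have := solvable_rank (map_mx (intr : int -> R) (coef_mx E)) (map_mx intr (const_row E)).
  rewrite -map_col_mx rank1 ?rank2 ?pnatr_eq0 -?lt0n // => <-.
  split=> -[x]; first by move=> /sol_real_form; rewrite on_form_mx => /eqP xE; exists x.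
  by move=> xE; exists x; apply/sol_real_form; rewrite on_form_mx; apply/eqP.
case: eqP => [/solE|neq]; first by move=> ?; rewrite asboolT // hornerXn -!natz natrX.
by rewrite asboolF ?horner0 // => /solE.
Qed.

(** Inclusion-exclusion over sublists on both sides; [Q] is the largest of the finitely many bounds
    met. *)
Theorem finite_field_method A : exists Q, forall q, prime q -> (Q < q)%N ->
  (#|[set x : 'rV['F_q]_n | all (fun h => ~~ on_form x h) A]%SET|)%:Z
  = (altsum (@solpoly R n) [::] (map real_form A)).[q%:Z].
Proof.
suff [Q QP] : exists Q, forall q, prime q -> (Q < q)%N ->
    altsum (fun E => (#|[set x : 'rV['F_q]_n | all (on_form x) E]%SET|)%:Z) [::] A
    = (altsum (@solpoly R n) (map real_form [::]) (map real_form A)).[q%:Z].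
  exists Q => q q_pr Qq; rewrite -QP // -card_on_form.
  by congr (Posz _); apply: eq_card => x; rewrite !inE.
elim: A [::] => [|h A IH] E /=; first exact: card_sol_solpoly.
have [Q1 Q1P] := IH E; have [Q2 Q2P] := IH (h :: E).
exists (maxn Q1 Q2) => q q_pr; rewrite gtn_max => /andP[Q1q Q2q].
by rewrite hornerD hornerN Q1P // Q2P.
Qed.

End FiniteField.

(** * Counting circular placements *)

Section Cardinals.

(** Finiteness is carried by a list because functions into [int] do not form a finite type. *)
Definition has_card (T : eqType) (P : T -> Prop) (N : nat) :=
  exists2 s : seq T, uniq s & (forall x, x \in s <-> P x) /\ size s = N.

(** Used for each insertion: [y] is the placement without the letter, [a] the position of the
    letter, and the number [c] of admissible positions is the same for all [y]. *)
Lemma has_card_dep (T U W : eqType) (P : T -> Prop) (Q : T -> U -> Prop)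
    (P' : W -> Prop) (f : T -> U -> W) N c :
  has_card P N -> (forall y, P y -> has_card (Q y) c) ->
  (forall y a, P y -> Q y a -> P' (f y a)) ->
  (forall x, P' x -> exists y a, [/\ P y, Q y a & x = f y a]) ->
  (forall y y' a a', P y -> Q y a -> P y' -> Q y' a' ->
     f y a = f y' a' -> y = y' /\ a = a') ->
  has_card P' (N * c).
Proof.
move=> [s s_uniq [sP sN]] Qc fP' P'f f_inj.
have /choice[t tP] y : exists t : seq U, P y ->
    [/\ uniq t, (forall a, a \in t <-> Q y a) & size t = c].
  have [/Qc[t t_uniq [tQ tc]]|nP] := pselect (P y); first by exists t.
  by exists [::] => /nP.
exists [seq f y a | y <- s, a <- t y].
  apply: allpairs_uniq_dep => //.
    by move=> y /sP /tP[].
  move=> p p' /allpairsPdep[y [a [/sP ys ay ->]]] /allpairsPdep[y' [a' [/sP ys' ay' ->]]] /=.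
  have [_ /(_ a)[Qa _] _] := tP _ ys; have [_ /(_ a')[Qa' _] _] := tP _ ys'.
  by move=> /(f_inj _ _ _ _ ys (Qa ay) ys' (Qa' ay'))[-> ->].
split=> [x|].
  split=> [/allpairsPdep[y [a [/sP ys ay ->]]]|/P'f[y [a [Py Qa ->]]]].
    by have [_ /(_ a)[/(_ ay) Qa _] _] := tP _ ys; exact: fP'.
  apply/allpairsPdep; exists y, a; split=> //; first exact/sP.
  by have [_ /(_ a)[_ ->]] := tP _ Py.
rewrite size_allpairs_dep -sN.
have sc y : y \in s -> size (t y) = c by move=> /sP /tP[].
elim: (s) sc => //= y s' IH sc; rewrite sc ?mem_head // IH ?mulSn // => z zs.
by apply: sc; rewrite inE zs orbT.
Qed.

Lemma eq_has_card (T : eqType) (P P' : T -> Prop) N :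
  (forall x, P x <-> P' x) -> has_card P N -> has_card P' N.
Proof.
move=> PP' [s s_uniq [sP sN]]; exists s => //; split=> // x.
by split=> [/sP/PP'|/PP'/sP].
Qed.

End Cardinals.

(* [stretch a] makes room for the new positions a and - a, [shrink a] undoes it. *)
Definition stretch (a z : int) : int :=
  if `|z| < `|a| then z else if 0 < z then z + 1 else z - 1.

Definition shrink (a z : int) : int :=
  if `|z| < `|a| then z else if 0 < z then z - 1 else z + 1.

Ltac split_ifs :=
  repeat match goal with |- context [if ?b then _ else _] =>
    lazymatch b with context [if _ then _ else _] => fail | _ => destruct b eqn:? end end.
Ltac shift_lia := rewrite /stretch /shrink; split_ifs; lia.

Section Insertion.
Variable n : nat.
Implicit Types (x y : {ffun 'I_n -> int}) (U : pred 'I_n) (u i j : 'I_n) (a z : int).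

(* Positions are the integers of absolute value at most M, arranged on a
   circle; i sits at x i and its opposite at - x i, and x i = 0 means that i is
   not placed. *)
Definition placement U (M : nat) x : Prop :=
  [/\ forall i, U i -> 0 < `|x i| <= M%:Z,
      forall i, ~~ U i -> x i = 0
    & forall i j, U i -> U j -> i != j -> `|x i| != `|x j| ].

Definition adjoin u U : pred 'I_n := fun i => (i == u) || U i.

Definition insert_at u a y : {ffun 'I_n -> int} :=
  [ffun i => if i == u then a else if y i == 0 then 0 else stretch a (y i)].

Lemma placement_insert U u M y a : ~~ U u -> placement U M y -> 0 < `|a| <= M.+1%:Z ->
  placement (adjoin u U) M.+1 (insert_at u a y).
Proof.
move=> nUu [yM y0 yD] aM; split=> [i|i|i j]; rewrite /adjoin ?negb_or !ffunE.
- case: eqVneq => [//|_] /= /yM; shift_lia.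
- by move=> /andP[/negPf-> /y0->].
- case: eqVneq => [->|iu]; case: eqVneq => [->|ju] //= Ui Uj ij.
  + by move: (yM _ Uj); shift_lia.
  + by move: (yM _ Ui); shift_lia.
  + by move: (yM _ Ui) (yM _ Uj) (yD _ _ Ui Uj ij); shift_lia.
Qed.

Lemma placement_shrink U u M x : ~~ U u -> placement (adjoin u U) M.+1 x ->
  exists2 y, placement U M y & x = insert_at u (x u) y.
Proof.
move=> nUu [xM x0 xD].
have Uu i : U i -> i != u by apply: contraTneq => ->.
have xuM : 0 < `|x u| <= M.+1%:Z by apply: xM; rewrite /adjoin eqxx.
have U' i : U i -> (adjoin u U) i by rewrite /adjoin => ->; rewrite orbT.
have uU' : (adjoin u U) u by rewrite /adjoin eqxx.
exists [ffun i => if U i then shrink (x u) (x i) else 0].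
  split=> [i Ui|i /negPf Ui|i j Ui Uj ij]; rewrite !ffunE ?Ui ?Uj //.
    by move: (xM _ (U' _ Ui)) (xD _ _ (U' _ Ui) uU' (Uu _ Ui)); shift_lia.
  move: (xM _ (U' _ Ui)) (xD _ _ (U' _ Ui) uU' (Uu _ Ui)).
  move: (xM _ (U' _ Uj)) (xD _ _ (U' _ Uj) uU' (Uu _ Uj)).
  by move: (xD _ _ (U' _ Ui) (U' _ Uj) ij); shift_lia.
apply/ffunP => i; rewrite !ffunE; case: eqVneq => [->//|iu].
case: (boolP (U i)) => [Ui|nUi] /=; last by rewrite x0 // /adjoin negb_or iu.
by move: (xM _ (U' _ Ui)) (xD _ _ (U' _ Ui) uU' (Uu _ Ui)); shift_lia.
Qed.

Lemma insert_inj U u M y y' a a' : ~~ U u -> placement U M y -> placement U M y' ->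
  0 < `|a| -> 0 < `|a'| ->
  insert_at u a y = insert_at u a' y' -> y = y' /\ a = a'.
Proof.
move=> nUu [yM y0 _] [yM' y0' _] a0 a0' /ffunP E.
have aa' : a = a' by have := E u; rewrite !ffunE eqxx.
split=> //; apply/ffunP => i; suff: y i = y' i :> int by [].
have : insert_at u a y i = insert_at u a' y' i :> int by exact: E.
rewrite !ffunE aa'.
case: eqVneq => [->|iu]; first by rewrite !(y0, y0').
case: (boolP (U i)) => [Ui|nUi]; last by rewrite !(y0, y0').
by move: (yM _ Ui) (yM' _ Ui); shift_lia.
Qed.

Lemma has_card_int (m : nat) : has_card (fun a : int => 0 < `|a| <= m%:Z) (2 * m).
Proof.
exists ([seq k%:Z + 1 | k <- iota 0 m] ++ [seq - (k%:Z + 1) | k <- iota 0 m]).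
  rewrite cat_uniq !map_inj_uniq ?iota_uniq ?andbT /=; last 2 first.
  - by move=> k l; lia.
  - by move=> k l; lia.
  by apply/hasPn => _ /mapP[k _ ->]; apply/mapP => -[l _]; lia.
split=> [a|]; last by rewrite size_cat !size_map size_iota; lia.
rewrite mem_cat; split=> [/orP[]/mapP[k]|].
- by rewrite mem_iota => km ->; lia.
- by rewrite mem_iota => km ->; lia.
case: (ltrP 0 a) => a0 am; apply/orP; [left|right]; apply/mapP; exists (absz a - 1)%N;
  rewrite ?mem_iota; lia.
Qed.

(** The letters are inserted one by one. As [stretch] makes room anywhere, every nonzero position
    within the new bound is available, whatever the earlier choices. *)
Lemma has_card_placement (s : seq 'I_n) (M : nat) : uniq s ->
  has_card (placement (mem s) (M + size s)) (\prod_(j < size s) (2 * (M + j.+1))).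
Proof.
elim: s => [_|u s IH /= /andP[us s_uniq]].
  exists [:: [ffun=> 0]] => //; rewrite big_ord0; split=> // x; rewrite inE; split.
    by move=> /eqP->; split=> // i _; rewrite ffunE.
  by move=> [_ x0 _]; apply/eqP/ffunP => i; rewrite x0 // ffunE.
rewrite big_ord_recr /=; apply: eq_has_card (has_card_dep (f := fun y a => insert_at u a y)
    (P' := placement (adjoin u (mem s)) (M + (size s).+1))
    (Q := fun _ (a : int) => 0 < `|a| <= (M + (size s).+1)%:Z) (IH s_uniq) _ _ _ _).
- move=> x; split=> -[xM x0 xD].
    by split.
  by split.
- by move=> y _; exact: has_card_int.
- by move=> y a yP aP; rewrite addnS in aP *; exact: placement_insert.
- rewrite addnS => x xP; have [y yP xE] := placement_shrink us xP.
  by exists y, (x u); split=> //; case: xP => + _ _; apply; rewrite /adjoin eqxx.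
- move=> y y' a a' yP /andP[a0 _] yP' /andP[a0' _].
  exact: insert_inj us yP yP' a0 a0'.
Qed.

End Insertion.

Section Avoidance.

Definition compatible (a v : int) : bool :=
  ((0 < a) ==> (a - 1 != v)) && ((a < 0) ==> (a != v)).

(* a corresponds to the gap following the point a - 1 if 0 < a, and following a
   otherwise, in the circle from which a and - a have been removed. *)
Lemma has_card_compatible (M : nat) (Y : seq int) :
  uniq Y -> (forall v, v \in Y -> `|v| <= M%:Z) ->
  has_card (fun a : int => [/\ 0 < `|a| <= M.+1%:Z, a != - M.+1%:Z
                             & forall v, v \in Y -> compatible a v])
           (2 * M + 1 - size Y).
Proof.
move=> Y_uniq YM.
pose r := [seq k%:Z - M%:Z | k <- iota 0 (2 * M + 1)].
have r_uniq : uniq r by rewrite map_inj_uniq ?iota_uniq // => k l; lia.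
have mem_r v : (v \in r) = (`|v| <= M%:Z).
  apply/mapP/idP => [[k]|vM]; first by rewrite mem_iota => kM ->; lia.
  by exists (absz (v + M%:Z)); rewrite ?mem_iota; lia.
(* [g v] is the position just after the old point [v]. The only nonzero value missed is [- M.+1],
   where the letter would directly follow its own opposite; hence one position per old point. *)
pose g (v : int) := if 0 <= v then v + 1 else v.
have g_inj : injective g by move=> v w; rewrite /g; split_ifs; lia.
exists [seq g v | v <- r & v \notin Y]; first by rewrite map_inj_uniq ?filter_uniq.
split=> [a|].
  split=> [/mapP[v]|[aM aN aY]].
    rewrite mem_filter mem_r => /andP[vY vM ->].
    have gvM : 0 < `|g v| <= M.+1%:Z by rewrite /g; split_ifs; lia.
    have gvN : g v != - M.+1%:Z by rewrite /g; split_ifs; lia.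
    split=> // w wY; have vw : v != w by apply: contraNneq vY => ->.
    by move: vw; rewrite /compatible /g; split_ifs; lia.
  apply/mapP; exists (if 0 < a then a - 1 else a); last by rewrite /g; split_ifs; lia.
  rewrite mem_filter mem_r; apply/andP; split; last by split_ifs; lia.
  by apply/negP => /aY; rewrite /compatible; split_ifs; lia.
rewrite size_map size_filter.
have := count_predC [in Y] r; rewrite -size_filter (perm_size (s2 := Y)).
  rewrite size_map size_iota => <-.
  by rewrite addnC addnK; apply: eq_count.
apply: uniq_perm; rewrite ?filter_uniq // => v.
by rewrite mem_filter mem_r andb_idr //; exact: YM.
Qed.

End Avoidance.

Section Configurations.
Variables (n : nat) (K : pred 'I_n).
Implicit Types (x y : {ffun 'I_n -> int}) (i j u s : 'I_n) (a : int).

(* The letters of K are removed in increasing order; t is the next candidate. *)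
Definition placed (t : nat) : pred 'I_n := fun i => ~~ K i || (t <= i)%N.

(* On the circle with 2 M + 1 points these are the conditions x s + x s' <> 1
   (s <= s') and x s - x (s' + 1) <> 1 (s <= s') modulo 2 M + 1. *)
Definition config (M t : nat) x : Prop :=
  [/\ placement (placed t) M x,
      forall s, K s -> (t <= s)%N -> x s != - M%:Z,
      forall s s', K s -> K s' -> (t <= s)%N -> (s < s')%N -> x s + x s' != 1
    & forall s s' j, K s -> K s' -> (t <= s)%N -> (s <= s')%N -> j = s'.+1 :> nat ->
        x s - x j != 1].

(** These are the conditions on the predecessor of the letter [t]; that this is not the opposite of
    [t] itself is the clause [a != - M.+1]. *)
Definition extension (M t : nat) y (a : int) : Prop :=
  [/\ 0 < `|a| <= M.+1%:Z, a != - M.+1%:Z,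
      forall s, K s -> (t < s)%N -> compatible a (- y s)
    & forall s j, K s -> (t <= s)%N -> j = s.+1 :> nat -> compatible a (y j)].

Definition remaining (t : nat) : nat := #|[pred s | K s && (t <= s)%N]|.

(** If the last index is in [K], it has no successor letter, and one forbidden predecessor is
    missing. *)
Definition defect : nat := ~~ [exists s, K s && (s.+1 == n)].

Lemma eq_placement (U U' : pred 'I_n) M x : U =1 U' -> placement U M x -> placement U' M x.
Proof.
by move=> UU' [xM x0 xD]; split=> [i|i|i j]; rewrite -!UU'; [exact: xM|exact: x0|exact: xD].
Qed.

Lemma add_placed u : K u -> adjoin u (placed u.+1) =1 placed u.
Proof.
by move=> Ku i; rewrite /adjoin /placed (leq_eqVlt u i) -val_eqE /= eq_sym; case: (K i); case: eqP.
Qed.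

(** The only new adjacencies involve [u] or [- u]. A letter [s] just after [- u] would by symmetry
    put [u] just after [- s], which [extension] excludes; [u] itself is no forbidden predecessor,
    every [s'.+1] in question being larger. *)
Lemma config_insert M u y a : K u -> config M u.+1 y -> extension M u y a ->
  config M.+1 u (insert_at u a y).
Proof.
move=> Ku [yP yb ya yc] [aM aN aK aH].
have nPu : ~~ placed u.+1 u by rewrite /placed Ku ltnn.
have [yM y0 yD] := yP.
have later s : (u < s)%N -> (s != u) && placed u.+1 s.
  by move=> us; rewrite /placed us orbT andbT -val_eqE gtn_eqF.
have value s : (u < s)%N -> insert_at u a y s = stretch a (y s) /\ 0 < `|y s| <= M%:Z.
  move=> /later/andP[/negPf su /yM ysM]; rewrite ffunE su; split=> //.
  by case: eqP => [ys0|//]; move: ysM; rewrite ys0; lia.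
have valu : insert_at u a y u = a by rewrite ffunE eqxx.
split.
- exact/(eq_placement (add_placed Ku))/placement_insert.
- move=> s Ks; rewrite leq_eqVlt => /orP[/eqP/val_inj <-|us]; first by rewrite valu.
  have [-> ysM] := value _ us; move: (yb _ Ks us) (aK _ Ks us).
  by rewrite /compatible; shift_lia.
- move=> s s' Ks Ks'; rewrite leq_eqVlt => /orP[/eqP/val_inj <-|us] ss'.
    have [-> ysM] := value _ ss'; move: (aK _ Ks' ss').
    by rewrite valu /compatible; shift_lia.
  have us' := ltn_trans us ss'; have [-> ysM] := value _ us; have [-> ysM'] := value _ us'.
  have ss'N : s != s' by rewrite -val_eqE ltn_eqF.
  have /andP[_ Ps] := later _ us; have /andP[_ Ps'] := later _ us'.
  move: (ya _ _ Ks Ks' us ss') (yD _ _ Ps Ps' ss'N) (aK _ Ks us) (aK _ Ks' us').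
  by rewrite /compatible; shift_lia.
- move=> s s' j Ks Ks' us ss' js'.
  have sj : (s < j)%N by rewrite js'.
  have uj : (u < j)%N by apply: leq_ltn_trans us sj.
  have [-> yjM] := value _ uj; move: (aH _ _ Ks' (leq_trans us ss') js') => aj.
  move: us; rewrite leq_eqVlt => /orP[/eqP/val_inj <-|us].
    by move: aj; rewrite valu /compatible; shift_lia.
  have [-> ysM] := value _ us; have sjN : s != j by rewrite -val_eqE ltn_eqF.
  have /andP[_ Ps] := later _ us; have /andP[_ Pj] := later _ uj.
  move: (yc _ _ _ Ks Ks' us ss' js') (yD _ _ Ps Pj sjN) (aK _ Ks us) aj.
  by rewrite /compatible; shift_lia.
Qed.

(** Letters made adjacent by the removal had [u], [- u] or both between them. What is forbidden
    before a later [s] is forbidden before [u] as well, and [- u] is forbidden before [s], so the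
    new adjacency is allowed. *)
Lemma config_shrink M u x : K u -> config M.+1 u x ->
  exists y a, [/\ config M u.+1 y, extension M u y a & x = insert_at u a y].
Proof.
move=> Ku [xP xb xa xc].
have nPu : ~~ placed u.+1 u by rewrite /placed Ku ltnn.
have [|y yP xE] := @placement_shrink _ (placed u.+1) u M x nPu.
  by apply: eq_placement xP => i; rewrite add_placed.
have [yM y0 yD] := yP.
set a := x u in xE.
have aM : 0 < `|a| <= M.+1%:Z by have [+ _ _] := xP; apply; rewrite /placed leqnn orbT.
have aN : a != - M.+1%:Z by exact: xb.
have later s : (u < s)%N -> (s != u) && placed u.+1 s.
  by move=> us; rewrite /placed us orbT andbT -val_eqE gtn_eqF.
have value s : (u < s)%N -> x s = stretch a (y s) /\ 0 < `|y s| <= M%:Z.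
  move=> /later/andP[/negPf su /yM ysM]; rewrite xE ffunE su; split=> //.
  by case: eqP => [ys0|//]; move: ysM; rewrite ys0; lia.
have aK s : K s -> (u < s)%N -> a + stretch a (y s) != 1.
  by move=> Ks us; have [<- _] := value _ us; exact: xa.
have aH s j : K s -> (u <= s)%N -> j = s.+1 :> nat -> a - stretch a (y j) != 1.
  move=> Ks us js; have uj : (u < j)%N by rewrite js ltnS.
  by have [<- _] := value _ uj; exact: (xc _ _ _ Ku Ks (leqnn u) us js).
exists y, a; split=> //.
- split=> //.
  + move=> s Ks us; have [xs ysM] := value _ us; move: (xb _ Ks (ltnW us)) (aK _ Ks us).
    by rewrite xs; shift_lia.
  + move=> s s' Ks Ks' us ss'; have us' := ltn_trans us ss'.
    have [xs ysM] := value _ us; have [xs' ysM'] := value _ us'.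
    move: (xa _ _ Ks Ks' (ltnW us) ss') (aK _ Ks us) (aK _ Ks' us').
    by rewrite xs xs'; shift_lia.
  + move=> s s' j Ks Ks' us ss' js'.
    have us' : (u <= s')%N by exact: leq_trans (ltnW us) ss'.
    have uj : (u < j)%N by rewrite js' ltnS.
    have [xs ysM] := value _ us; have [xj yjM] := value _ uj.
    move: (xc _ _ _ Ks Ks' (ltnW us) ss' js') (aK _ Ks us) (aH _ _ Ks' us' js').
    by rewrite xs xj; shift_lia.
- split=> // [s Ks us|s j Ks us js].
    have [_ ysM] := value _ us; move: (aK _ Ks us).
    by rewrite /compatible; shift_lia.
  have uj : (u < j)%N by rewrite js ltnS.
  have [_ yjM] := value _ uj; move: (aH _ _ Ks us js).
  by rewrite /compatible; shift_lia.
Qed.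

Lemma remaining_in u : K u -> remaining u = (remaining u.+1).+1.
Proof.
move=> Ku; rewrite /remaining (cardD1 u) inE /= Ku leqnn add1n; congr S.
apply: eq_card => s; rewrite !inE (leq_eqVlt u s) -val_eqE /= eq_sym.
by case: (ltngtP u s); rewrite ?andbF ?andbT.
Qed.

Lemma remaining_notin u : ~~ K u -> remaining u = remaining u.+1.
Proof.
move=> Ku; apply: eq_card => s; rewrite !inE (leq_eqVlt u s).
by case: eqP => [/val_inj <-|]//; rewrite (negPf Ku).
Qed.

Lemma card_heads u : K u ->
  #|[pred s | [&& K s, (u <= s)%N & s.+1 != n]]| = (remaining u.+1 + defect)%N.
Proof.
move=> Ku; have := remaining_in Ku; rewrite /defect.
have [/existsP[s0 /andP[Ks0 /eqP s0n]]|none] /= := boolP [exists s, K s && (s.+1 == n)].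
  have us0 : (u <= s0)%N by rewrite -ltnS s0n.
  rewrite /remaining (cardD1 s0) inE /= Ks0 us0 add1n addn0 => /succn_inj <-.
  have s0E s : (s == s0) = (s.+1 == n) by rewrite -val_eqE -eqSS /= s0n.
  apply: eq_card => s; rewrite !inE s0E.
  by case: (s.+1 == n); rewrite ?andbF ?andbT.
rewrite addn1 => <-; apply: eq_card => s; rewrite !inE.
case: (boolP (K s)) => //= Ks; case: eqP => [sn|]; rewrite ?andbT //.
by case/existsP: none; exists s; rewrite Ks sn eqxx.
Qed.

(** Placed letters have distinct nonzero absolute values, so the forbidden predecessors occupy
    distinct points and it suffices to count the letters. *)
Lemma has_card_extension M u y : K u -> config M u.+1 y ->
  has_card (extension M u y) (2 * M + 1 - (2 * remaining u.+1 + defect)).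
Proof.
move=> Ku [[yM y0 yD] _ _ _].
pose later := [seq s <- enum 'I_n | K s && (u < s)%N].
pose heads := [seq j <- enum 'I_n | [exists s, [&& K s, (u <= s)%N & val j == s.+1]]].
pose Y := [seq - y s | s <- later] ++ [seq y j | j <- heads].
have later_uniq : uniq later by exact/filter_uniq/enum_uniq.
have heads_uniq : uniq heads by exact/filter_uniq/enum_uniq.
have mem_later s : (s \in later) = K s && (u < s)%N by rewrite mem_filter mem_enum andbT.
have headsP j : reflect (exists s, [/\ K s, (u <= s)%N & j = s.+1 :> nat]) (j \in heads).
  rewrite mem_filter mem_enum andbT; apply: (iffP existsP) => -[s].
    by move=> /and3P[? ? /eqP]; exists s.
  by move=> [? ? js]; exists s; apply/and3P; split=> //; rewrite -js.
have later_placed s : (u < s)%N -> placed u.+1 s by move=> us; rewrite /placed us orbT.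
have heads_later j : j \in heads -> (u < j)%N by move=> /headsP[s [_ us ->]]; rewrite ltnS.
have y_inj i j : (u < i)%N -> (u < j)%N -> `|y i| = `|y j| -> i = j.
  move=> ui uj yij; apply/eqP/negPn/negP => /(yD _ _ (later_placed _ ui) (later_placed _ uj)).
  by rewrite yij eqxx.
have Y_uniq : uniq Y.
  rewrite cat_uniq; apply/and3P; split.
  - rewrite map_inj_in_uniq // => i j.
    by rewrite !mem_later => /andP[_ ui] /andP[_ uj] E; apply: y_inj => //; lia.
  - apply/hasPn => _ /mapP[j jH ->]; apply/mapP => -[s]; rewrite mem_later => /andP[_ us] E.
    have uj := heads_later _ jH.
    have js : j = s by apply: y_inj => //; lia.
    by move: (yM _ (later_placed _ us)) E; rewrite js; lia.
  - rewrite map_inj_in_uniq // => i j.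
    by move=> /heads_later ui /heads_later uj E; apply: y_inj => //; lia.
have YM v : v \in Y -> `|v| <= M%:Z.
  rewrite mem_cat => /orP[] /mapP[i iL ->].
    by move: iL; rewrite mem_later => /andP[_ /later_placed/yM]; lia.
  by move/heads_later/later_placed/yM: iL; lia.
have sizeY : size Y = (2 * remaining u.+1 + defect)%N.
  have size_later : size later = remaining u.+1.
    rewrite /remaining cardE; apply/perm_size/uniq_perm => //; first exact: enum_uniq.
    by move=> s; rewrite mem_later mem_enum.
  rewrite size_cat !size_map size_later mul2n -addnn -addnA; congr (_ + _)%N.
  rewrite -(size_map val heads).
  rewrite (@perm_size _ _ (map (succn \o val) (enum [pred s | [&& K s, (u <= s)%N & s.+1 != n]]))).
    by rewrite size_map -cardE; apply: card_heads.
  apply: uniq_perm.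
  - by rewrite map_inj_uniq //; exact: val_inj.
  - by rewrite map_inj_uniq ?enum_uniq // => i j [/val_inj].
  move=> k; apply/mapP/mapP => -[].
    move=> j /headsP[s [Ks us js]] ->; exists s => //=.
    by rewrite mem_enum inE Ks us /= neq_ltn -js ltn_ord.
  move=> s; rewrite mem_enum inE => /and3P[Ks us sn] /= ->.
  have sn' : (s.+1 < n)%N by rewrite ltn_neqAle sn ltn_ord.
  by exists (Ordinal sn') => //; apply/headsP; exists s.
rewrite -sizeY; apply: eq_has_card (has_card_compatible Y_uniq YM) => a; split=> -[aM aN].
  move=> aY; split=> // [s Ks us|s j Ks us js]; apply: aY; rewrite mem_cat; apply/orP.
    by left; apply/mapP; exists s; rewrite // mem_later Ks.
  by right; apply/map_f/headsP; exists s.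
move=> aK aH; split=> // v; rewrite mem_cat => /orP[] /mapP[i iY ->].
  by move: iY; rewrite mem_later => /andP[]; exact: aK.
by move/headsP: iY => [s [Ks us]]; exact: aH.
Qed.

Lemma has_card_config M N t : has_card (placement (predC K) M) N -> (t <= n)%N ->
  has_card (config (M + remaining t) t) (N * (2 * M + 1 - defect) ^ remaining t).
Proof.
move=> NP; have [d] := ubnP (n - t); elim: d t => // d IH t; rewrite ltnS => ltd.
rewrite leq_eqVlt => /orP[/eqP->|tn].
  have rn : remaining n = 0%N by apply: eq_card0 => s; rewrite !inE leqNgt ltn_ord andbF.
  rewrite rn addn0 expn0 muln1; apply: eq_has_card NP => x; split=> [xP|[xP _ _ _]].
    split; first by apply: eq_placement xP => i; rewrite /placed leqNgt ltn_ord orbF.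
    - by move=> s _; rewrite leqNgt ltn_ord.
    - by move=> s s' _ _; rewrite leqNgt ltn_ord.
    - by move=> s s' j _ _; rewrite leqNgt ltn_ord.
  by apply: eq_placement xP => i; rewrite /placed leqNgt ltn_ord orbF.
have IHt := IH t.+1 (leq_trans (ltn_sub2l tn (ltnSn t)) ltd) tn.
have [Ku|nKu] := boolP (K (Ordinal tn)); last first.
  have -> : remaining t = remaining t.+1 := remaining_notin nKu.
  have tK s : K s -> (t <= s)%N = (t < s)%N.
    by move=> Ks; rewrite leq_eqVlt; case: eqP => // ts; move: nKu; rewrite (_ : Ordinal tn = s) ?Ks //; apply: val_inj.
  have PP : placed t.+1 =1 placed t.
    by move=> i; rewrite /placed; case: (boolP (K i)) => //= /tK ->.
  apply: eq_has_card IHt => x; split=> -[xP xb xa xc]; split.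
  - exact: eq_placement xP.
  - by move=> s Ks; rewrite tK //; exact: xb.
  - by move=> s s' Ks Ks'; rewrite tK //; exact: xa.
  - by move=> s s' j Ks Ks'; rewrite tK //; exact: xc.
  - by apply: eq_placement xP => i; rewrite PP.
  - by move=> s Ks; rewrite -tK //; exact: xb.
  - by move=> s s' Ks Ks'; rewrite -tK //; exact: xa.
  - by move=> s s' j Ks Ks'; rewrite -tK //; exact: xc.
have -> : remaining t = (remaining t.+1).+1 := remaining_in Ku.
rewrite expnSr mulnA addnS.
have := (@has_card_dep _ _ _ _ (extension (M + remaining t.+1) (Ordinal tn))
  (config (M + remaining t.+1).+1 t) (fun y a => insert_at (Ordinal tn) a y) _ (2 * M + 1 - defect) IHt).
apply.
(* Each remaining letter adds two points to the circle and two forbidden predecessors. *)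
- move=> y yP; have -> : (2 * M + 1 - defect
    = 2 * (M + remaining t.+1) + 1 - (2 * remaining t.+1 + defect))%N by lia.
  exact: (has_card_extension Ku yP).
- by move=> y a; exact: (@config_insert _ (Ordinal tn) y a Ku).
- by move=> x; exact: (@config_shrink _ (Ordinal tn) x Ku).
- move=> y y' a a' [yP _ _ _] [/andP[a0 _] _ _ _] [yP' _ _ _] [/andP[a0' _] _ _ _].
  by apply: insert_inj yP yP' a0 a0'; rewrite /placed Ku ltnn.
Qed.

End Configurations.

(** * The points of the reduced arrangement *)

Lemma Fp_intr_eq0 q (z : int) : prime q -> (z%:~R == 0 :> 'F_q) = (q %| absz z)%N.
Proof.
move=> q_pr; have dvdE m : (m%:R == 0 :> 'F_q) = (q %| m)%N.
  by rewrite -(dvdn_pcharf (pchar_Fp q_pr)).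
by case: z => m; rewrite ?NegzE ?rmorphN /= ?oppr_eq0 -[_%:~R]/(_%:R) dvdE.
Qed.

Section Balanced.
Variable M : nat.
Let q := (2 * M + 1)%N.
Hypothesis q_pr : prime q.

Lemma intr_balanced_eq0 (z : int) : `|z| <= (2 * M)%:Z -> (z%:~R == 0 :> 'F_q) = (z == 0).
Proof.
move=> zM; rewrite Fp_intr_eq0 //; have [->|z0] := eqVneq z 0; first by rewrite dvdn0.
by apply/negbTE; rewrite gtnNdvd //; lia.
Qed.

(** In this range 1 is congruent only to itself and to 1 - (2 M + 1). *)
Lemma intr_balanced_eq1 (z : int) : `|z| <= (2 * M)%:Z ->
  (z%:~R == 1 :> 'F_q) = (z == 1) || (z == - (2 * M)%:Z).
Proof.
move=> zM; rewrite -subr_eq0 -[1]/(1%:~R) -rmorphB /= Fp_intr_eq0 //.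
apply/dvdnP/orP => [[k kE]|[/eqP->|/eqP->]]; last 2 first.
- by exists 0%N; rewrite subrr.
- by exists 1%N; rewrite /q; lia.
have [k2|] := ltnP k 2; last by move: kE; rewrite /q; nia.
have [k0|k1] : k = 0%N \/ k = 1%N by lia.
  by left; move: kE; rewrite k0; lia.
by right; move: kE; rewrite k1 /q; lia.
Qed.

Lemma balanced_repr (u : 'F_q) : exists2 z : int, `|z| <= M%:Z & u = z%:~R.
Proof.
have uq : (u < q)%N by have := ltn_ord u; rewrite [X in (_ < X)%N]Fp_cast.
have [k kq uE] : exists2 k : nat, (k < q)%N & u = k%:R.
  by exists u; rewrite // natr_Zp.
have [kM|kM] := leqP k M; first by exists k%:Z => //; lia.
exists (k%:Z - q%:Z); first by move: kq kM; rewrite /q; lia.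
have -> : (k%:Z - q%:Z)%:~R = k%:~R - q%:~R :> 'F_q by rewrite rmorphB.
have /eqP -> : q%:~R == 0 :> 'F_q by rewrite Fp_intr_eq0 // dvdnn.
by rewrite subr0 uE.
Qed.

End Balanced.

Section ShiForms.
Variables (n : nat) (K : pred 'I_n).
Implicit Types (i j s : 'I_n) (p : 'I_n * 'I_n).

(** The sums with [p.1 = p.2] are the long roots. *)
Definition shi_forms : seq ('rV[int]_n * int) :=
  [seq (delta_mx 0 p.1 + delta_mx 0 p.2, 0) | p <- enum {: 'I_n * 'I_n} & (p.1 <= p.2)%N]
  ++ [seq (delta_mx 0 p.1 - delta_mx 0 p.2, 0) | p <- enum {: 'I_n * 'I_n} & (p.1 < p.2)%N]
  ++ [seq (delta_mx 0 p.1 + delta_mx 0 p.2, 1) | p <- enum {: 'I_n * 'I_n}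
        & [&& K p.1, K p.2 & (p.1 <= p.2)%N]]
  ++ [seq (delta_mx 0 p.1 - delta_mx 0 p.2, 1) | p <- enum {: 'I_n * 'I_n}
        & K p.1 && [exists s, [&& K s, (p.1 <= s)%N & val p.2 == s.+1]]].

Lemma shi_formsP h : h \in shi_forms <->
  (exists i j, [/\ (i <= j)%N & h = (delta_mx 0 i + delta_mx 0 j, 0)]) \/
  (exists i j, [/\ (i < j)%N & h = (delta_mx 0 i - delta_mx 0 j, 0)]) \/
  (exists i j, [/\ K i, K j, (i <= j)%N & h = (delta_mx 0 i + delta_mx 0 j, 1)]) \/
  (exists i j s, [/\ K i, K s, (i <= s)%N, j = s.+1 :> nat
                   & h = (delta_mx 0 i - delta_mx 0 j, 1)]).
Proof.
rewrite /shi_forms !mem_cat; split.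
  move=> /or4P[] /mapP[[i j]]; rewrite mem_filter => /andP[/= Pij _] ->.
  - by left; exists i, j.
  - by right; left; exists i, j.
  - by right; right; left; exists i, j; case/and3P: Pij.
  - case/andP: Pij => Ki /existsP[s /and3P[Ks is_ /eqP js]].
    by right; right; right; exists i, j, s.
move=> [[i [j [ij ->]]]|[[i [j [ij ->]]]|[[i [j [Ki Kj ij ->]]]|[i [j [s [Ki Ks is_ js ->]]]]]]];
  apply/or4P; [apply: Or41|apply: Or42|apply: Or43|apply: Or44];
  apply/mapP; exists (i, j) => //; rewrite mem_filter mem_enum andbT //=.
- by rewrite Ki Kj.
- by rewrite Ki; apply/existsP; exists s; rewrite Ks is_ js /=.
Qed.

Lemma on_formD (F : fieldType) (x : 'rV[F]_n) i j (c : int) :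
  on_form x (delta_mx 0 i + delta_mx 0 j, c) = (x 0 i + x 0 j == c%:~R).
Proof.
rewrite /on_form /=; congr (_ == _).
rewrite (eq_bigr (fun k => x 0 k * (k == i)%:R + x 0 k * (k == j)%:R)); last first.
  by move=> k _; rewrite !mxE eqxx /= rmorphD /= mulrDr !rmorph_nat.
have pick k : \sum_(l < n) x 0 l * (l == k)%:R = x 0 k.
  rewrite (bigD1 k) //= eqxx mulr1 big1 ?addr0 // => l /negPf->; exact: mulr0.
by rewrite big_split /= !pick.
Qed.

Lemma on_formB (F : fieldType) (x : 'rV[F]_n) i j (c : int) :
  on_form x (delta_mx 0 i - delta_mx 0 j, c) = (x 0 i - x 0 j == c%:~R).
Proof.
rewrite /on_form /=; congr (_ == _).
rewrite (eq_bigr (fun k => x 0 k * (k == i)%:R - x 0 k * (k == j)%:R)); last first.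
  by move=> k _; rewrite !mxE eqxx /= rmorphB /= mulrBr !rmorph_nat.
have pick k : \sum_(l < n) x 0 l * (l == k)%:R = x 0 k.
  rewrite (bigD1 k) //= eqxx mulr1 big1 ?addr0 // => l /negPf->; exact: mulr0.
by rewrite sumrB !pick.
Qed.

(** A sum or difference equal to [- 2 M] has both terms extremal, so the two coordinates have equal
    absolute value. This is already excluded, except for [x s + x s], where it is the clause
    [x s != - M]. *)
Lemma avoid_shi_forms (M : nat) (x : {ffun 'I_n -> int}) : prime (2 * M + 1) ->
  (forall i, `|x i| <= M%:Z) ->
  all (fun h => ~~ on_form (\row_i ((x i)%:~R : 'F_(2 * M + 1))) h) shi_forms <->
  config K M 0 x.
Proof.
move=> q_pr xM; set v := \row_i _.
have sum0 i j : (v 0 i + v 0 j == 0) = (x i + x j == 0).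
  by rewrite !mxE -rmorphD intr_balanced_eq0 //; move: (xM i) (xM j); lia.
have dif0 i j : (v 0 i - v 0 j == 0) = (x i - x j == 0).
  by rewrite !mxE -rmorphB intr_balanced_eq0 //; move: (xM i) (xM j); lia.
have sum1 i j : (v 0 i + v 0 j == 1) = (x i + x j == 1) || (x i + x j == - (2 * M)%:Z).
  by rewrite !mxE -rmorphD intr_balanced_eq1 //; move: (xM i) (xM j); lia.
have dif1 i j : (v 0 i - v 0 j == 1) = (x i - x j == 1) || (x i - x j == - (2 * M)%:Z).
  by rewrite !mxE -rmorphB intr_balanced_eq1 //; move: (xM i) (xM j); lia.
split=> [/allP av|[[xp _ xD] xb xa xc]].
  have avS i j : (i <= j)%N -> x i + x j != 0.
    move=> ij; rewrite -sum0 -(mulr0z 1) -on_formD; apply: av; apply/shi_formsP.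
    by left; exists i, j.
  have avB i j : (i < j)%N -> x i - x j != 0.
    move=> ij; rewrite -dif0 -(mulr0z 1) -on_formB; apply: av; apply/shi_formsP.
    by right; left; exists i, j.
  have avS1 i j : K i -> K j -> (i <= j)%N -> ~~ ((x i + x j == 1) || (x i + x j == - (2 * M)%:Z)).
    move=> Ki Kj ij; rewrite -sum1 -(mulr1z 1) -on_formD; apply: av; apply/shi_formsP.
    by right; right; left; exists i, j.
  have avB1 i s j : K i -> K s -> (i <= s)%N -> j = s.+1 :> nat ->
      ~~ ((x i - x j == 1) || (x i - x j == - (2 * M)%:Z)).
    move=> Ki Ks is_ js; rewrite -dif1 -(mulr1z 1) -on_formB; apply: av; apply/shi_formsP.
    by right; right; right; exists i, j, s.
  split.
  - split=> [i _|i|i j _ _]; first by move: (avS i i (leqnn i)) (xM i); lia.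
      by rewrite /placed orbT.
    rewrite neq_ltn => /orP[] ij.
      by move: (avS _ _ (ltnW ij)) (avB _ _ ij); lia.
    by move: (avS _ _ (ltnW ij)) (avB _ _ ij); lia.
  - by move=> s Ks _; move: (avS1 _ _ Ks Ks (leqnn s)); lia.
  - by move=> s s' Ks Ks' _ ss'; move: (avS1 _ _ Ks Ks' (ltnW ss')); lia.
  - by move=> s s' j Ks Ks' _ ss' js'; move: (avB1 _ _ _ Ks Ks' ss' js'); lia.
have xpos i : 0 < `|x i| by have /andP[] := xp i (orbT _).
have xdist i j : (i < j)%N -> `|x i| != `|x j|.
  by move=> ij; apply: xD; rewrite /placed ?orbT // -val_eqE neq_ltn ij.
apply/allP => h /shi_formsP.
move=> [[i [j [ij ->]]]|[[i [j [ij ->]]]|[[i [j [Ki Kj ij ->]]]|[i [j [s [Ki Ks is_ js ->]]]]]]].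
- rewrite on_formD mulr0z sum0; move: ij; rewrite leq_eqVlt => /orP[/eqP/val_inj->|ij].
    by move: (xpos j); lia.
  by move: (xdist _ _ ij); lia.
- by rewrite on_formB mulr0z dif0; move: (xdist _ _ ij); lia.
- rewrite on_formD mulr1z sum1; move: ij; rewrite leq_eqVlt => /orP[/eqP/val_inj ij|ij].
    by rewrite ij; move: (xb _ Kj (leq0n _)); lia.
  by move: (xdist _ _ ij) (xa _ _ Ki Kj (leq0n _) ij) (xM i) (xM j); lia.
- have ij : (i < j)%N by rewrite js.
  rewrite on_formB mulr1z dif1.
  by move: (xdist _ _ ij) (xc _ _ _ Ki Ks (leq0n _) is_ js) (xM i) (xM j); lia.
Qed.

Lemma card_avoid_shi_forms (M N : nat) : prime (2 * M + 1) -> has_card (config K M 0) N ->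
  #|[set v : 'rV['F_(2 * M + 1)]_n | all (fun h => ~~ on_form v h) shi_forms]%SET| = N.
Proof.
move=> q_pr [t t_uniq [tP <-]].
pose phi (x : {ffun 'I_n -> int}) := \row_i ((x i)%:~R : 'F_(2 * M + 1)).
have bnd x : x \in t -> forall i, `|x i| <= M%:Z.
  by move=> /tP[[xM _ _] _ _ _] i; have /andP[] := xM i (orbT _).
have phi_inj : {in t &, injective phi}.
  move=> x y /bnd xM /bnd yM /rowP E; apply/ffunP => i.
  suff /eqP: x i == y i :> int by [].
  rewrite -subr_eq0 -(intr_balanced_eq0 q_pr); last by move: (xM i) (yM i); lia.
  by rewrite rmorphB /= subr_eq0; apply/eqP; have := E i; rewrite !mxE.
rewrite -(size_map phi) -(card_uniqP _); last by rewrite map_inj_in_uniq.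
apply: eq_card => v; rewrite inE; apply/idP/mapP => [av|[x xt ->]]; last first.
  by apply/avoid_shi_forms => //; [exact: bnd|exact/tP].
have /choice[z zP] i : exists z : int, `|z| <= M%:Z /\ v 0 i = z%:~R.
  by have [z] := balanced_repr q_pr (v 0 i); exists z.
have vE : v = phi [ffun i => z i] by apply/rowP => i; rewrite !mxE ffunE (zP i).2.
exists [ffun i => z i] => //; apply/tP; apply/avoid_shi_forms => //.
  by move=> i; rewrite ffunE (zP i).1.
by rewrite -[\row_i _]/(phi _) -vE.
Qed.

End ShiForms.

(** * The roots of type C and the set C_I *)

Section Roots.
Variables (R : realType) (n : nat).
Local Notation V := 'rV[R]_n.
Implicit Types (i j s a b : 'I_n) (v w : V).

Definition unit_vec i : V := delta_mx 0 i.
Local Notation e := unit_vec.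

Lemma inner_unit_vec i w : inner (e i) w = w 0 i.
Proof.
rewrite /inner (bigD1 i) //= mxE !eqxx mul1r big1 ?addr0 // => j /negPf ji.
by rewrite mxE ji mul0r.
Qed.

Lemma ebasis_ord i : ebasis R n i.+1 = e i.
Proof. by apply/rowP => j; rewrite !mxE eqSS val_eqE. Qed.

Lemma pos_rootsP v : pos_roots v <->
  exists i j, ((i <= j)%N /\ v = e i + e j) \/ ((i < j)%N /\ v = e i - e j).
Proof.
split.
  move=> [[i [j [i1 ij jn vE]]]|[i [/andP[i1 iN] ->]]].
    have in' : (i.-1 < n)%N by lia.
    have jn' : (j.-1 < n)%N by lia.
    have iE : ebasis R n i = e (Ordinal in') by rewrite -ebasis_ord /= prednK.
    have jE : ebasis R n j = e (Ordinal jn') by rewrite -ebasis_ord /= prednK //; lia.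
    by exists (Ordinal in'), (Ordinal jn'); rewrite -iE -jE; case: vE => ->; [left|right];
       split=> //=; lia.
  have in' : (i.-1 < n)%N by lia.
  exists (Ordinal in'), (Ordinal in'); left; split=> //.
  by rewrite -ebasis_ord /= prednK // scaler_nat mulr2n.
move=> [i [j [[ij ->]|[ij ->]]]]; rewrite -!ebasis_ord.
  move: ij; rewrite leq_eqVlt => /orP[/eqP->|ij].
    by right; exists j.+1; split; [have := ltn_ord j; lia|rewrite scaler_nat mulr2n].
  by left; exists i.+1, j.+1; split => //; left.
by left; exists i.+1, j.+1; split => //; right.
Qed.

Lemma pos_root_root v : pos_roots v -> root_system v.
Proof. by left. Qed.

Lemma root_inner_le v w : (forall i, `|w 0 i| <= 1) -> root_system v -> inner v w <= 2.
Proof.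
move=> w1; have bnd u : pos_roots u -> `|inner u w| <= 2.
  move=> /pos_rootsP[i [j [[_ ->]|[_ ->]]]].
    by rewrite innerDl !inner_unit_vec (le_trans (ler_normD _ _)) // lerD.
  by rewrite innerBl !inner_unit_vec (le_trans (ler_normB _ _)) // lerD.
move=> [/bnd|[u /bnd + <-]]; first exact: le_trans (ler_norm _).
by rewrite innerNl -normrN; exact: le_trans (ler_norm _).
Qed.

Definition sign_vec (P : pred 'I_n) : V := \row_i (if P i then 1 else -1).

(* The absolute values of the coordinates of a root add up to 2. *)
Lemma inner_sign_vec_not_root P v : inner v (sign_vec P) = 4 -> ~ root_system v.
Proof.
move=> v4 /(@root_inner_le v (sign_vec P)); rewrite v4 => le42.
suff : (4 : R) <= 2 by lra.
by apply: le42 => i; rewrite mxE; case: ifP; rewrite ?normrN normr1.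
Qed.

Definition simple i : V := if (i.+1 < n)%N then ebasis R n i.+1 - ebasis R n i.+2
                           else 2 *: ebasis R n i.+1.

Lemma simple_lt i j : j = i.+1 :> nat -> simple i = e i - e j.
Proof. by move=> ji; rewrite /simple -ji ltn_ord ebasis_ord ji ebasis_ord. Qed.

Lemma simple_last i : i.+1 = n -> simple i = e i + e i.
Proof. by move=> iN; rewrite /simple ebasis_ord iN ltnn scaler_nat mulr2n. Qed.

(* Up to a factor 2 for the last one, these are the fundamental coweights. *)
Definition prefix_vec i : V := \row_j (j <= i)%:R.

Lemma inner_prefix_simple i j : inner (simple i) (prefix_vec j) != 0 -> i = j.
Proof.
have [iN|iN] := ltnP i.+1 n.
  rewrite (@simple_lt i (Ordinal iN)) // innerBl !inner_unit_vec !mxE /=.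
  case: (ltngtP i j) => [|ij|/val_inj//]; first by rewrite subrr eqxx.
  by rewrite subr0 eqxx.
have iE : i.+1 = n by apply/eqP; rewrite eqn_leq iN ltn_ord.
rewrite simple_last // innerDl !inner_unit_vec !mxE.
case: (ltngtP i j) => [ij|_|/val_inj//]; last by rewrite addr0 eqxx.
by have jn := ltn_ord j; exfalso; lia.
Qed.

Lemma simple_inj : injective simple.
Proof.
move=> i j ij; apply: inner_prefix_simple; rewrite ij.
have [jN|jN] := ltnP j.+1 n.
  rewrite (@simple_lt j (Ordinal jN)) // innerBl !inner_unit_vec !mxE /= leqnn ltnn subr0.
  exact: oner_neq0.
have jE : j.+1 = n by apply/eqP; rewrite eqn_leq jN ltn_ord.
by rewrite simple_last // innerDl !inner_unit_vec !mxE leqnn -natrD pnatr_eq0.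
Qed.

Lemma simple_rootsP v : (0 < n)%N -> simple_roots v <-> exists i, v = simple i.
Proof.
move=> n0; split.
  move=> [[i [/andP[i1 iN] ->]]|->].
    have in' : (i.-1 < n)%N by lia.
    by exists (Ordinal in'); rewrite /simple /= prednK // iN.
  have nn : (n.-1 < n)%N by lia.
  by exists (Ordinal nn); rewrite /simple /= prednK // ltnn.
move=> [i ->]; rewrite /simple; case: ltnP => iN; first by left; exists i.+1.
by right => /=; congr (_ *: ebasis R n _); apply/eqP; rewrite eqn_leq iN ltn_ord.
Qed.

Section Parabolic.
Variable I : {fset V}.
Hypothesis I_simple : [set` I] `<=` simple_roots (R := R) (n := n).

Definition outer : pred 'I_n := fun i => simple i \notin I.

Lemma sub_roots_prefix v s : outer s -> sub_roots I v -> inner v (prefix_vec s) = 0.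
Proof.
move=> sI [_ vI]; apply/eqP; rewrite -innerhomE -memv_ker.
apply: subvP vI; apply/span_subvP => u uI; rewrite memv_ker innerhomE.
have n0 : (0 < n)%N by exact: leq_ltn_trans (leq0n _) (ltn_ord s).
have /(simple_rootsP _ n0)[i uE] : simple_roots u by exact: I_simple.
apply/negPn/negP; rewrite uE => /inner_prefix_simple is_.
by move: sI; rewrite /outer -is_ -uE uI.
Qed.

Lemma simple_pos i : pos_roots (simple i).
Proof.
apply/pos_rootsP; have [iN|iN] := ltnP i.+1 n.
  by exists i, (Ordinal iN); right; rewrite -simple_lt.
exists i, i; left; split=> //; rewrite simple_last //.
by apply/eqP; rewrite eqn_leq iN ltn_ord.
Qed.

Lemma simple_sub_roots i : ~~ outer i -> sub_roots I (simple i).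
Proof.
rewrite negbK => iI; split; first exact/pos_root_root/simple_pos.
exact: memv_span.
Qed.

(** If the simple root at an end of [v] is in [I], subtracting it leaves a root or shows that [v] is
    in the subsystem. Conversely, pairing with the prefix vectors of outer indices shows that a
    positive root of the subsystem cancels no coordinate of [v]; a suitable sign vector then takes
    the value 4 on the difference. *)
Lemma shi_rootsP v : shi_roots I v <->
  (exists i j, [/\ outer i, outer j, (i <= j)%N & v = e i + e j]) \/
  (exists i j s, [/\ outer i, outer s, (i <= s)%N, j = s.+1 :> nat & v = e i - e j]).
Proof.
split.
  move=> [/pos_rootsP[i [j vE]] vI vmin].
  have vmin' k : ~~ outer k -> ~ root_system (v - simple k).
    by move=> kI; apply: vmin; split; [exact: simple_sub_roots|exact: simple_pos].
  case: vE => -[ij vE].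
    have jO : outer j.
      apply: contraT => jI; case: (vmin' _ jI); rewrite vE.
      have [jN|jN] := ltnP j.+1 n.
        rewrite (@simple_lt j (Ordinal jN)) // opprB addrCA addrK addrC.
        by apply/pos_root_root/pos_rootsP; exists i, (Ordinal jN); left; split=> //=; exact: leqW.
      have jE : j.+1 = n by apply/eqP; rewrite eqn_leq jN ltn_ord.
      rewrite simple_last // opprD addrA addrK.
      move: ij; rewrite leq_eqVlt => /orP[/eqP/val_inj ij|ij]; last first.
        by apply/pos_root_root/pos_rootsP; exists i, j; right.
      by case: vI; rewrite vE ij -simple_last //; exact: simple_sub_roots.
    left; exists i, j; split=> //; apply: contraT => iI.
    have {}ij : (i < j)%N.
      by rewrite ltn_neqAle ij andbT; apply: contraNneq iI => /val_inj ->.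
    have iN : (i.+1 < n)%N by exact: leq_ltn_trans ij (ltn_ord j).
    case: (vmin' _ iI); rewrite vE (@simple_lt i (Ordinal iN)) // opprB addrC addrA subrK.
    by apply/pos_root_root/pos_rootsP; exists (Ordinal iN), j; left.
  right; have iN : (i.+1 < n)%N by exact: leq_ltn_trans ij (ltn_ord j).
  have jN : (j.-1 < n)%N by have := ltn_ord j; lia.
  have jS : j = (Ordinal jN).+1 :> nat by rewrite /=; lia.
  exists i, j, (Ordinal jN); split=> //=; last by lia.
    apply: contraT => iI; case: (vmin' _ iI); rewrite vE (@simple_lt i (Ordinal iN)) //.
    rewrite opprB addrC addrA subrK.
    have [ij'|ij'] := eqVneq i.+1 j.
      case: vI; rewrite vE -(@simple_lt i j) //; exact: simple_sub_roots.
    by apply/pos_root_root/pos_rootsP; exists (Ordinal iN), j; right; split=> //=; rewrite ltn_neqAle ij'.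
  apply: contraT => jI; case: (vmin' _ jI); rewrite vE (@simple_lt (Ordinal jN) j) //.
  rewrite opprB addrA subrK.
  have [ij'|ij'] := eqVneq i (Ordinal jN).
    case: vI; rewrite vE ij' -(@simple_lt (Ordinal jN) j) //; exact: simple_sub_roots.
  apply/pos_root_root/pos_rootsP; exists i, (Ordinal jN); right; split=> //=.
  by move: ij'; rewrite -val_eqE /=; lia.
have neg w s : outer s -> inner w (prefix_vec s) != 0 -> ~ sub_roots I w.
  by move=> sO w0 /(sub_roots_prefix sO) /eqP; rewrite (negPf w0).
move=> [[i [j [iO jO ij ->]]]|[i [j [s [iO sO is_ js ->]]]]].
  split; first by apply/pos_rootsP; exists i, j; left.
    apply: (neg _ i) => //; rewrite innerDl !inner_unit_vec !mxE leqnn.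
    by rewrite -natrD pnatr_eq0.
  move=> w [wI /pos_rootsP[a [b [[ab wE]|[ab wE]]]]].
    have wj : inner w (prefix_vec j) = 0 by exact: sub_roots_prefix.
    have aj : (j < a)%N.
      rewrite ltnNge; apply/negP => aj; move: wj; rewrite wE innerDl !inner_unit_vec !mxE aj.
      by move/eqP; rewrite -natrD pnatr_eq0.
    apply: (@inner_sign_vec_not_root [pred k | (k == i) || (k == j)]).
    rewrite wE innerBl !innerDl !inner_unit_vec !mxE /= !eqxx orbT.
    have ia : (i < a)%N by exact: leq_ltn_trans ij aj.
    rewrite -!val_eqE /= !gtn_eqF //; last 2 first.
    - exact: leq_trans ab.
    - exact: leq_trans ab.
    by rewrite /=; lra.
  (* [w] is the sum of the simple roots of indices [a] to [b - 1], so none of these may be outer. *)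
  have zero s : outer s -> ~~ ((a <= s)%N && (s < b)%N).
    move=> sO; apply/negP => /andP[as_ sb].
    have := sub_roots_prefix sO wI; rewrite wE innerBl !inner_unit_vec !mxE as_ leqNgt sb.
    by move/eqP; rewrite subr0 oner_eq0.
  apply: (@inner_sign_vec_not_root [pred k | [|| k == i, k == j | k == b]]).
  rewrite wE innerBl innerBl !innerDl !inner_unit_vec !mxE /= !eqxx !orbT.
  have ai : (a == i) = false by apply/negbTE; apply: contraNneq (zero _ iO) => <-; rewrite leqnn.
  have aj : (a == j) = false by apply/negbTE; apply: contraNneq (zero _ jO) => <-; rewrite leqnn.
  have abN : (a == b) = false by rewrite -val_eqE ltn_eqF.
  by rewrite ai aj abN /=; lra.
have ij : (i < j)%N by rewrite js.
split; first by apply/pos_rootsP; exists i, j; right.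
  by apply: (neg _ i) => //; rewrite innerBl !inner_unit_vec !mxE leqnn leqNgt ij subr0 oner_neq0.
move=> w [wI /pos_rootsP[a [b [[ab wE]|[ab wE]]]]].
  have ws : inner w (prefix_vec s) = 0 by exact: sub_roots_prefix.
  have as_ : (s < a)%N.
    rewrite ltnNge; apply/negP => aj; move: ws; rewrite wE innerDl !inner_unit_vec !mxE aj.
    by move/eqP; rewrite -natrD pnatr_eq0.
  have ia : (i < a)%N by exact: leq_ltn_trans is_ as_.
  apply: (@inner_sign_vec_not_root [pred k | k == i]).
  rewrite wE innerBl innerBl !innerDl !inner_unit_vec !mxE /= !eqxx -!val_eqE /= !gtn_eqF //.
    by lra.
  exact: leq_trans ab.
have zero k : outer k -> ~~ ((a <= k)%N && (k < b)%N).
  move=> kO; apply/negP => /andP[ak kb].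
  have := sub_roots_prefix kO wI; rewrite wE innerBl !inner_unit_vec !mxE ak leqNgt kb.
  by move/eqP; rewrite subr0 oner_eq0.
apply: (@inner_sign_vec_not_root [pred k | (k == i) || (k == b)]).
rewrite wE !innerBl !inner_unit_vec !mxE /= !eqxx !orbT.
have ai : (a == i) = false by apply/negbTE; apply: contraNneq (zero _ iO) => <-; rewrite leqnn.
have ji : (j == i) = false by rewrite -val_eqE gtn_eqF.
have jb : (j == b) = false.
  apply/negbTE; apply: contraNneq (zero _ sO) => jb; rewrite -jb js ltnS leqnn andbT.
  by move: ab; rewrite -jb js.
have abN : (a == b) = false by rewrite -val_eqE ltn_eqF.
by rewrite ai ji jb abN /=; lra.
Qed.

End Parabolic.
End Roots.

(** * The characteristic polynomial *)

Lemma poly_eq_primes (p p' : {poly int}) Q :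
  (forall q, prime q -> (Q < q)%N -> p.[q%:Z] = p'.[q%:Z]) -> p = p'.
Proof.
move=> pp'; apply/eqP; rewrite -subr_eq0; apply/negPn/negP => d0.
have [rs [rs_uniq rs_root size_rs]] : exists rs : seq nat,
    [/\ uniq rs, all (fun q => root (p - p') q%:Z) rs & size rs = size (p - p')].
  suff [rs [rs_uniq rsP <-]] : exists rs : seq nat,
      [/\ uniq rs, all (fun q => prime q && (Q < q)%N) rs & size rs = size (p - p')].
    exists rs; split=> //; apply: sub_all rsP => q /andP[q_pr Qq].
    by rewrite /root hornerD hornerN pp' // subrr.
  elim: (size _) => [|m [rs [rs_uniq rsP <-]]]; first by exists [::].
  have [q q_lt q_pr] := prime_above (maxn Q (\max_(x <- rs) x)).
  move: q_lt; rewrite gtn_max => /andP[Qq rsq].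
  exists (q :: rs); split=> //=; last by rewrite q_pr Qq.
  rewrite rs_uniq andbT; apply/negP => qrs.
  have := @leq_bigmax_seq _ rs xpredT id q qrs isT.
  by rewrite leqNgt rsq.
have := max_poly_roots d0 (rs := [seq Posz q | q <- rs]).
rewrite all_map map_inj_uniq ?rs_uniq; last by move=> a b [].
by rewrite size_map size_rs ltnn => /(_ rs_root isT).
Qed.

(** Here [k = n - r], and [d] is 1 or 0 according as 2 e_n is in I or not. For [d = 1] the term
    [j = 0] equals the repeated exponent, whence the multiplicity n - r + 1. *)
Definition shi_exponents (k r d : nat) : seq nat :=
  nseq k (2 * k + d)%N ++ [seq (2 * k + 1 + 2 * j)%N | j <- iota 0 r].

Definition exponent_poly (ms : seq nat) : {poly int} := \prod_(m <- ms) ('X - (m%:Z)%:P).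

Lemma horner_exponent_poly ms x : (exponent_poly ms).[x] = \prod_(m <- ms) (x - m%:Z).
Proof. by rewrite horner_prod; apply: eq_bigr => m _; rewrite hornerXsubC. Qed.

Lemma dfact_prod k r : dfact (2 * (k + r)) = (dfact (2 * k) * \prod_(j < r) (2 * k + 2 * j + 2))%N.
Proof.
elim: r => [|r IH]; first by rewrite addn0 big_ord0 muln1.
rewrite big_ord_recr /= addnS mulnS mulnA -IH [in LHS]/= mulnC; congr (_ * _)%N; lia.
Qed.

Lemma big_shi_exponents (S : Type) (idx : S) (op : Monoid.law idx) (f : nat -> S) k r d :
  \big[op/idx]_(m <- shi_exponents k r d) f m =
  op (iter k (op (f (2 * k + d)%N)) idx) (\big[op/idx]_(j < r) f (2 * k + 1 + 2 * j)%N).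
Proof.
rewrite big_cat big_map /= big_nseq.
by rewrite -(big_mkord xpredT (fun j => f (2 * k + 1 + 2 * j)%N)) /index_iota subn0.
Qed.

Lemma size_shi_exponents k r d : size (shi_exponents k r d) = (k + r)%N.
Proof. by rewrite size_cat size_nseq size_map size_iota. Qed.

Lemma exponent_poly_N1 ms :
  (exponent_poly ms).[-1] = (-1) ^+ size ms * (\prod_(m <- ms) m.+1)%N%:Z.
Proof.
rewrite horner_exponent_poly; elim: ms => [|m ms IH]; first by rewrite !big_nil.
by rewrite !big_cons IH /= exprS PoszM; ring.
Qed.

(** Positivity of the exponents keeps [m.-1] from being truncated. *)
Lemma exponent_poly_1 ms : all (leq 1) ms ->
  (exponent_poly ms).[1] = (-1) ^+ size ms * (\prod_(m <- ms) m.-1)%N%:Z.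
Proof.
rewrite horner_exponent_poly; elim: ms => [|m ms IH /= /andP[m1 /IH msE]]; first by rewrite !big_nil.
rewrite !big_cons msE exprS PoszM.
have -> : 1 - m%:Z = - (m.-1)%:Z by lia.
by ring.
Qed.

Lemma exponents_poly (R : realType) (n : nat) (A : set (set 'rV[R]_n)) ms :
  arr_poly A = exponent_poly ms -> perm_eq (exponents A) [seq m%:R | m <- ms].
Proof.
move=> AE; rewrite /exponents; case: closed_field_poly_normal => rs /=.
rewrite AE /exponent_poly rmorph_prod /=.
have -> : \prod_(m <- ms) map_poly intr ('X - (m%:Z)%:P)
    = \prod_(z <- [seq m%:R | m <- ms]) ('X - z%:P) :> {poly algC}.
  by rewrite big_map; apply: eq_bigr => m _; rewrite rmorphB /= map_polyX map_polyC.
rewrite (monicP (monic_prod_XsubC _ _ _)) scale1r => E.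
by rewrite perm_sym; apply: prod_XsubC_eq.
Qed.

Section ShiArrangement.
Variables (R : realType) (n : nat) (I : {fset 'rV[R]_n}).
Hypothesis n_gt0 : (0 < n)%N.
Hypothesis I_simple : [set` I] `<=` simple_roots (R := R) (n := n).
Implicit Types (i j s : 'I_n).
Local Notation K := (outer I).
Local Notation forms := (map (@real_form R n) (shi_forms K)).

Lemma real_formD i j (c : int) :
  real_form R (delta_mx 0 i + delta_mx 0 j, c) = (unit_vec R i + unit_vec R j, c%:~R).
Proof. by rewrite /real_form /= map_mxD !map_delta_mx. Qed.

Lemma real_formB i j (c : int) :
  real_form R (delta_mx 0 i - delta_mx 0 j, c) = (unit_vec R i - unit_vec R j, c%:~R).
Proof. by rewrite /real_form /= map_mxB !map_delta_mx. Qed.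

Lemma Shi_forms : Shi I = arrangement forms.
Proof.
apply/seteqP; split => H.
  move=> [[v /pos_rootsP[i [j [[ij ->]|[ij ->]]]] <-]|[v /(shi_rootsP I_simple) vS <-]].
  - exists (real_form R (delta_mx 0 i + delta_mx 0 j, 0)); last by rewrite real_formD.
    by apply/map_f/shi_formsP; left; exists i, j.
  - exists (real_form R (delta_mx 0 i - delta_mx 0 j, 0)); last by rewrite real_formB.
    by apply/map_f/shi_formsP; right; left; exists i, j.
  case: vS => [[i [j [iO jO ij ->]]]|[i [j [s [iO sO is_ js ->]]]]].
    exists (real_form R (delta_mx 0 i + delta_mx 0 j, 1)); last by rewrite real_formD.
    by apply/map_f/shi_formsP; right; right; left; exists i, j.
  exists (real_form R (delta_mx 0 i - delta_mx 0 j, 1)); last by rewrite real_formB.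
  by apply/map_f/shi_formsP; right; right; right; exists i, j, s.
move=> [_ /mapP[h /shi_formsP hF ->] ->].
case: hF => [[i [j [ij ->]]]|[[i [j [ij ->]]]|[[i [j [Ki Kj ij ->]]]|[i [j [s [Ki Ks is_ js ->]]]]]]].
- rewrite real_formD; left; exists (unit_vec R i + unit_vec R j) => //.
  by apply/pos_rootsP; exists i, j; left.
- rewrite real_formB; left; exists (unit_vec R i - unit_vec R j) => //.
  by apply/pos_rootsP; exists i, j; right.
- rewrite real_formD; right; exists (unit_vec R i + unit_vec R j) => //.
  by apply/(shi_rootsP I_simple); left; exists i, j.
- rewrite real_formB; right; exists (unit_vec R i - unit_vec R j) => //.
  by apply/(shi_rootsP I_simple); right; exists i, j, s.
Qed.

Lemma unit_vecD_neq0 i j : unit_vec R i + unit_vec R j != 0.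
Proof.
apply/eqP => /rowP /(_ i); rewrite !mxE !eqxx /= => /eqP.
by rewrite -natrD pnatr_eq0.
Qed.

Lemma unit_vecB_neq0 i j : (i < j)%N -> unit_vec R i - unit_vec R j != 0.
Proof.
move=> ij; apply/eqP => /rowP /(_ i); rewrite !mxE !eqxx /= -val_eqE /= ltn_eqF // => /eqP.
by rewrite subr0 oner_eq0.
Qed.

Lemma forms_proper h : h \in forms -> h.1 != 0.
Proof.
move=> /mapP[h' /shi_formsP hF ->].
case: hF => [[i [j [ij ->]]]|[[i [j [ij ->]]]|[[i [j [Ki Kj ij ->]]]|[i [j [s [Ki Ks is_ js ->]]]]]]].
- by rewrite real_formD unit_vecD_neq0.
- by rewrite real_formB unit_vecB_neq0.
- by rewrite real_formD unit_vecD_neq0.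
- by rewrite real_formB unit_vecB_neq0 // js.
Qed.

Lemma forms_essential w : (forall h, h \in forms -> inner w h.1 = 0) -> w = 0.
Proof.
move=> w0; apply/rowP => i; rewrite mxE.
have := w0 (real_form R (delta_mx 0 i + delta_mx 0 i, 0)).
rewrite real_formD /= innerDr !(innerC w) inner_unit_vec => H.
have : w 0 i + w 0 i = 0; last by lra.
by apply/H/mapP; exists (delta_mx 0 i + delta_mx 0 i, 0); rewrite ?real_formD //;
   apply/shi_formsP; left; exists i, i.
Qed.

Lemma card_fset_outer : #|` I| = #|[predC K]|.
Proof.
rewrite cardE -(size_map (@simple R n)).
apply/perm_size/uniq_perm; first exact: fset_uniq.
  by rewrite map_inj_uniq ?enum_uniq //; exact: simple_inj.
move=> v; apply/idP/mapP => [vI|[i]]; last by rewrite mem_enum inE negbK => iI ->.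
have /(simple_rootsP _ n_gt0)[i vE] : simple_roots v by exact: I_simple.
by exists i => //; rewrite mem_enum inE negbK -vE.
Qed.

Lemma arr_poly_Shi :
  arr_poly (Shi I) = exponent_poly (shi_exponents #|K| #|` I| (defect K)).
Proof.
set k := #|K|; set r := #|` I|; set d := defect K.
have krn : (k + r = n)%N by rewrite /r card_fset_outer cardC card_ord.
rewrite Shi_forms arr_poly_altsum; last exact: forms_proper.
have [Q QP] := finite_field_method R (shi_forms K).
apply: (@poly_eq_primes _ _ (maxn Q (2 * n + 1))) => q q_pr.
rewrite gtn_max => /andP[Qq nq]; rewrite -QP //.
have [M qE] : exists M, q = (2 * (M + r + k) + 1)%N.
  have [q2|q_odd] := even_prime q_pr; first by lia.
  by exists (q./2 - n)%N; have := odd_double_half q; rewrite q_odd -muln2; lia.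
(* The [r] letters outside [K] are placed first, without restriction, on the circle of 2 (M + r) + 1
   points. *)
have Kc : has_card (placement (predC K) (M + r)) (\prod_(j < r) (2 * (M + j.+1))).
  have := has_card_placement M (enum_uniq [predC K]).
  rewrite -cardE -card_fset_outer; apply: eq_has_card => x.
  have E : mem (enum [predC K]) =1 predC K by move=> i; exact: mem_enum.
  by split; apply: eq_placement => i; rewrite E.
have := has_card_config Kc (leq0n n).
have -> : remaining K 0 = k by apply: eq_card => s; rewrite !inE andbT.
rewrite qE in q_pr *; move=> /(card_avoid_shi_forms q_pr) ->.
rewrite horner_exponent_poly big_shi_exponents iter_mulr_1 -/d PoszM mulrC.
have d1 : (d <= 1)%N by rewrite /d /defect; case: (~~ _).
(* Each letter of [K] contributes 2 (M + r) + 1 - d = q - (2 k + d). *)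
congr (_ * _); first by rewrite -!natz natrX natz; congr (_ ^+ _); lia.
(* Read backwards, the other factors are 2 (M + r - l) = q - (2 k + 1 + 2 l). *)
rewrite -(big_mkord xpredT (fun l => 2 * (M + l.+1))%N) big_nat_rev big_mkord.
rewrite -natz natr_prod; apply: eq_bigr => l _; rewrite natz.
by have := ltn_ord l; lia.
Qed.

Lemma shi_exponents_gt0 k r d : (0 < k)%N -> all (leq 1) (shi_exponents k r d).
Proof.
move=> k0; rewrite all_cat all_nseq all_map; apply/andP; split; first by apply/orP; right; lia.
by apply/allP => l _ /=; lia.
Qed.

Lemma defect_outer : defect K = (2 *: ebasis R n n \in I).
Proof.
have nn : (n.-1 < n)%N by rewrite prednK.
have lastE : simple R (Ordinal nn) = 2 *: ebasis R n n.
  by rewrite /simple /= prednK // ltnn.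
rewrite /defect -lastE -[_ \in I]negbK; congr (nat_of_bool (~~ _)).
apply/existsP/idP => [[s /andP[sO /eqP sn]]|lastO]; last first.
  by exists (Ordinal nn); rewrite /outer lastO /= prednK // eqxx.
by rewrite (_ : Ordinal nn = s) //; apply: ord_inj => /=; lia.
Qed.

Lemma card_regions_Shi k r d : #|K| = k -> #|` I| = r -> defect K = d ->
  (regions (Shi I) #= `I_((2 * k + d).+1 ^ k * \prod_(j < r) (2 * k + 2 * j + 2)))%card.
Proof.
move=> kE rE dE; have chi := arr_poly_Shi; rewrite kE rE dE in chi.
have krn : (k + r = n)%N by rewrite -kE -rE card_fset_outer cardC card_ord.
rewrite Shi_forms in chi *; apply: zaslavsky_regions; first exact: forms_proper.
rewrite chi exponent_poly_N1 size_shi_exponents krn big_shi_exponents iter_muln_1.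
by congr (_ * Posz (_ * _)%N); apply: eq_bigr => l _; lia.
Qed.

Lemma card_bounded_regions_Shi k r d : #|K| = k -> #|` I| = r -> defect K = d -> (0 < k)%N ->
  (bounded_regions (Shi I) #= `I_((2 * k + d).-1 ^ k * \prod_(j < r) (2 * k + 2 * j)))%card.
Proof.
move=> kE rE dE k0; have chi := arr_poly_Shi; rewrite kE rE dE in chi.
have krn : (k + r = n)%N by rewrite -kE -rE card_fset_outer cardC card_ord.
rewrite Shi_forms in chi *; apply: zaslavsky_bounded.
- exact: forms_proper.
- exact: forms_essential.
rewrite chi exponent_poly_1 ?shi_exponents_gt0 // size_shi_exponents krn.
rewrite big_shi_exponents iter_muln_1.
by congr (_ * Posz (_ * _)%N); apply: eq_bigr => l _; lia.
Qed.

End ShiArrangement.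

Lemma shi_exponents_0 k r :
  shi_exponents k r 0 = nseq k (2 * k)%N ++ [seq (2 * k + 1 + 2 * j)%N | j <- iota 0 r].
Proof. by rewrite /shi_exponents addn0. Qed.

Lemma shi_exponents_1 k r : (0 < r)%N -> shi_exponents k r 1
  = nseq (k + 1) (2 * k + 1)%N ++ [seq (2 * k + 1 + 2 * j)%N | j <- iota 1 (r - 1)].
Proof.
case: r => // r _; rewrite /shi_exponents nseqD -catA /= muln0 addn0 subn1.
by [].
Qed.

Lemma dfact_gt0 m : (0 < dfact m)%N.
Proof.
have [k] := ubnP m; elim: k m => // k IH [|[|m]] //= mk.
by rewrite muln_gt0 /= IH //; lia.
Qed.

Lemma divn_dfact (a k r P : nat) : P = (\prod_(j < r) (2 * k + 2 * j + 2))%N ->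
  (a * dfact (2 * (k + r)) %/ dfact (2 * k) = a * P)%N.
Proof. by move=> ->; rewrite dfact_prod mulnCA mulKn // dfact_gt0. Qed.

Theorem theorem5p1 (R : realType) (n r : nat) (I : {fset 'rV[R]_n})
    (hn : (2 <= n)%N) (hr : (1 <= r <= n.-1)%N)
    (hI : [set` I] `<=` @simple_roots R n) (hcard : #|` I| = r) :
  (2 *: ebasis R n n \in I ->
    [/\ forall J : {fset 'rV[R]_n},
          [set` J] `<=` @simple_roots R n -> #|` J| = r ->
          2 *: ebasis R n n \in J ->
          arr_poly (Shi J) = arr_poly (Shi I),
        perm_eq (exponents (Shi I))
          [seq m%:R | m <- nseq (n - r + 1) (2 * n - 2 * r + 1)%N
                        ++ [seq (2 * n - 2 * r + 1 + 2 * k)%N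
                              | k <- iota 1 (r - 1)]],
        (regions (Shi I) #=
          `I_((2 * n - 2 * r + 2) ^ (n - r) * dfact (2 * n)
                %/ dfact (2 * n - 2 * r)))%card
      & (bounded_regions (Shi I) #=
          `I_((2 * n - 2 * r) ^ (n - r) * dfact (2 * n - 2)
                %/ dfact (2 * n - 2 * r - 2)))%card])
  /\
  (2 *: ebasis R n n \notin I ->
    [/\ forall J : {fset 'rV[R]_n},
          [set` J] `<=` @simple_roots R n -> #|` J| = r ->
          2 *: ebasis R n n \notin J ->
          arr_poly (Shi J) = arr_poly (Shi I),
        perm_eq (exponents (Shi I))
          [seq m%:R | m <- nseq (n - r) (2 * n - 2 * r)%N
                        ++ [seq (2 * n - 2 * r + 1 + 2 * k)%N
                              | k <- iota 0 r]],
        (regions (Shi I) #=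
          `I_((2 * n - 2 * r + 1) ^ (n - r) * dfact (2 * n)
                %/ dfact (2 * n - 2 * r)))%card
      & (bounded_regions (Shi I) #=
          `I_((2 * n - 2 * r - 1) ^ (n - r) * dfact (2 * n - 2)
                %/ dfact (2 * n - 2 * r - 2)))%card]).
Proof.
have n0 : (0 < n)%N by lia.
pose k := (n - r)%N.
have krn : (k + r = n)%N by rewrite /k; lia.
have outerE (J : {fset 'rV[R]_n}) : [set` J] `<=` @simple_roots R n -> #|` J| = r ->
    #|outer J| = k.
  move=> J_simple Jr; have := cardC (outer J).
  rewrite card_ord -(card_fset_outer n0 J_simple) Jr -[in X in _ = X -> _]krn.
  exact: addIn.
have regE d : ((2 * k + d).+1 ^ k * dfact (2 * n) %/ dfact (2 * n - 2 * r) =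
    (2 * k + d).+1 ^ k * \prod_(j < r) (2 * k + 2 * j + 2))%N.
  rewrite -(divn_dfact _ (erefl _)) krn; congr (_ %/ dfact _)%N; lia.
have bndE d : ((2 * k + d).-1 ^ k * dfact (2 * n - 2) %/ dfact (2 * n - 2 * r - 2) =
    (2 * k + d).-1 ^ k * \prod_(j < r) (2 * k + 2 * j))%N.
  (* As [r < n], [k] is positive, and the bounded count is the double factorial quotient for
     [k - 1]. *)
  have -> : (2 * n - 2 = 2 * (k.-1 + r))%N by lia.
  have -> : (2 * n - 2 * r - 2 = 2 * k.-1)%N by lia.
  by apply: divn_dfact; apply: eq_bigr => j _; lia.
have kI := outerE I hI hcard.
have chi J (J_simple : [set` J] `<=` @simple_roots R n) (Jr : #|` J| = r) :=
  arr_poly_Shi n0 J_simple.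
have dE := defect_outer I n0.
have kE : (2 * k = 2 * n - 2 * r)%N by rewrite /k; lia.
split=> lastI; rewrite ?lastI ?(negPf lastI) /= in dE; split.
- move=> J J_simple Jr lastJ.
  by rewrite !chi // !outerE // Jr hcard !defect_outer // lastJ lastI.
- apply: perm_trans (exponents_poly (chi I hI hcard)) _.
  by rewrite kI hcard dE shi_exponents_1 -?kE //; lia.
- have := card_regions_Shi n0 hI kI hcard dE; rewrite -regE.
  by have -> : ((2 * k + 1).+1 = 2 * n - 2 * r + 2)%N by lia.
- have := card_bounded_regions_Shi n0 hI kI hcard dE; rewrite -bndE.
  have -> : ((2 * k + 1).-1 = 2 * n - 2 * r)%N by lia.
  by apply; lia.
- move=> J J_simple Jr lastJ.
  by rewrite !chi // !outerE // Jr hcard !defect_outer // (negPf lastJ) (negPf lastI).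
- apply: perm_trans (exponents_poly (chi I hI hcard)) _.
  by rewrite kI hcard dE shi_exponents_0 kE.
- have := card_regions_Shi n0 hI kI hcard dE; rewrite -regE.
  by have -> : ((2 * k + 0).+1 = 2 * n - 2 * r + 1)%N by lia.
- have := card_bounded_regions_Shi n0 hI kI hcard dE; rewrite -bndE.
  have -> : ((2 * k + 0).-1 = 2 * n - 2 * r - 1)%N by lia.
  by apply; lia.
Qed.
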